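(* Let $n\ge 1$, let $\boldsymbol{a},\boldsymbol{b}\in\mathbb{R}^n$ with $a_i<b_i$ for all $i$, and let $f:[\boldsymbol{a},\boldsymbol{b}]\to\mathbb{R}$ be of bounded variation on the rectangle $[\boldsymbol{a},\boldsymbol{b}]=\prod_{i=1}^n[a_i,b_i]$. Then $f$ is absolutely continuous on $[\boldsymbol{a},\boldsymbol{b}]$ if and only if $$\int_{[\boldsymbol{a},\boldsymbol{b}]}|f^{(n)}(\boldsymbol{x})|\,d\boldsymbol{x}=\bigvee_{\boldsymbol{a}}^{\boldsymbol{b}}(f).$$
   Context: For $\boldsymbol{c},\boldsymbol{d}\in\mathbb{R}^n$ with $c_i\le d_i$ for all $i$, $[\boldsymbol{c},\boldsymbol{d}]=\prod_i[c_i,d_i]$. The joint increment of $f$ over $[\boldsymbol{c},\boldsymbol{d}]$ is $$\Delta_f^n[\boldsymbol{c},\boldsymbol{d}]=\sum_{\epsilon_1,\dots,\epsilon_n\in\{0,1\}}(-1)^{n+\epsilon_1+\dots+\epsilon_n}f\big(c_1+\epsilon_1(d_1-c_1),\dots,c_n+\epsilon_n(d_n-c_n)\big).$$ The joint derivative of $f$ at a point $\boldsymbol{x}$ in a neighborhood of which $f$ is defined is $$f^{(n)}(\boldsymbol{x})=\lim_{h\to0^+}\frac{\Delta_f^n\big([x_1,x_1+h]\times\dots\times[x_n,x_n+h]\big)}{h^n},$$ when the limit exists (as a finite real number); for $f$ of bounded variation it exists almost everywhere in $[\boldsymbol{a},\boldsymbol{b}]$ and is Lebesgue integrable. The total variation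 of $f$ on $[\boldsymbol{a},\boldsymbol{b}]$ is $$\bigvee_{\boldsymbol{a}}^{\boldsymbol{b}}(f)=\sup_{\Delta}\sum_{i=1}^{N^n}|\Delta_f^nI_i|,$$ where the supremum is over all $N\ge1$ and all grid partitions $\Delta: a_i=x_{i0}<x_{i1}<\dots<x_{iN}=b_i$ ($i=1,\dots,n$), and $I_1,\dots,I_{N^n}$ are the closed sub-rectangles generated by $\Delta$. $f$ is of bounded variation on $[\boldsymbol{a},\boldsymbol{b}]$ if $\bigvee_{\boldsymbol{a}}^{\boldsymbol{b}}(f)<+\infty$. $f$ is absolutely continuous on $[\boldsymbol{a},\boldsymbol{b}]$ if for every $\varepsilon>0$ there is $\delta>0$ such that for every finite collection of closed sub-rectangles $I_1,\dots,I_N\subset[\boldsymbol{a},\boldsymbol{b}]$ (with sides parallel to the axes) with pairwise disjoint interiors and $\sum_{i=1}^N m(I_i)<\delta$ one has $\sum_{i=1}^N|\Delta_f^nI_i|<\varepsilon$, where $m$ is $n$-dimensional Lebesgue measure. *)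

(* Defs.v *)
From HB Require Import structures.
From mathcomp Require Import all_boot all_order all_algebra.
From mathcomp Require Import all_classical all_reals all_analysis.

Set Implicit Arguments.
Unset Strict Implicit.
Unset Printing Implicit Defensive.

Import Order.TTheory GRing.Theory Num.Theory.
Import numFieldNormedType.Exports.

Local Open Scope classical_set_scope.
Local Open Scope ring_scope.

(* The sigma-algebra on R^n generated by the coordinates, i.e. the Borel
   sets; same construction as the library's instance on [n.-tuple T]. *)
Section rV_measurable.
Context {R : realType} (n : nat).

Let coord (i : 'I_n) (x : 'rV[R]_n) : measurableTypeR R := x 0 i.

Let rV_measurable0 : g_sigma_preimage coord set0.
Proof. exact: sigma_algebra0. Qed.

Let rV_measurableC A : g_sigma_preimage coord A -> g_sigma_preimage coord (~` A).
Proof. exact: sigma_algebraC. Qed.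

Let rV_measurable_bigcup (F : (set 'rV[R]_n)^nat) :
  (forall k, g_sigma_preimage coord (F k)) ->
  g_sigma_preimage coord (\bigcup_k F k).
Proof. exact: sigma_algebra_bigcup. Qed.

HB.instance Definition _ := @isMeasurable.Build default_measure_display
  'rV[R]_n (g_sigma_preimage coord)
  rV_measurable0 rV_measurableC rV_measurable_bigcup.

End rV_measurable.

Lemma measurable_rV_coord {R : realType} n (i : 'I_n) :
  measurable_fun [set: 'rV[R]_n] (fun x => x 0 i : measurableTypeR R).
Proof.
move=> _ Y mY; rewrite setTI; apply: sub_sigma_algebra => /=.
rewrite -bigcup_seq/=; exists i => /=; first by rewrite mem_index_enum.
by exists Y => //; rewrite setTI.
Qed.

Lemma measurable_fun_rVP {R : realType} d (T : measurableType d) n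
    (f : T -> 'rV[R]_n) :
  (forall i, measurable_fun [set: T] (fun t => f t 0 i : measurableTypeR R)) ->
  measurable_fun [set: T] f.
Proof.
move=> mf _ Y mY; rewrite setTI.
move: Y mY.
pose G := [set Y : set 'rV[R]_n | measurable (f @^-1` Y)].
suff : (measurable : set (set 'rV[R]_n)) `<=` G by exact.
apply: smallest_sub.
  split => /=.
  - by rewrite /G/= preimage_set0; exact: measurable0.
  - by move=> A GA; rewrite setTD /G/= preimage_setC; exact: measurableC.
  - by move=> F GF; rewrite /G/= preimage_bigcup; exact: bigcupT_measurable.
move=> A; rewrite -bigcup_seq/= => -[i _ [B mB <-]].
by rewrite /G/= setTI -[X in measurable X]setTI; exact: mf.
Qed.

Definition rV_cons {R : realType} n (p : measurableTypeR R * 'rV[R]_n) :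
  'rV[R]_n.+1 := row_mx (p.1)%:M p.2.

Definition rV_uncons {R : realType} n (x : 'rV[R]_n.+1) :
  measurableTypeR R * 'rV[R]_n := (x 0 ord0, \row_i x 0 (lift ord0 i)).

Lemma rV_cons0 {R : realType} n (p : measurableTypeR R * 'rV[R]_n) :
  rV_cons p 0 ord0 = p.1.
Proof.
rewrite /rV_cons (_ : ord0 = lshift n (ord0 : 'I_1)); last exact/val_inj.
by rewrite [LHS]row_mxEl mxE eqxx mulr1n.
Qed.

Lemma rV_consS {R : realType} n (p : measurableTypeR R * 'rV[R]_n) i :
  rV_cons p 0 (lift ord0 i) = p.2 0 i.
Proof.
rewrite /rV_cons (_ : lift ord0 i = rshift 1 i); last exact/val_inj.
by rewrite [LHS]row_mxEr.
Qed.

Lemma rV_consK {R : realType} n : cancel (@rV_cons R n) (@rV_uncons R n).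
Proof.
move=> [r x]; rewrite /rV_uncons rV_cons0; congr pair.
by apply/rowP => i; rewrite mxE rV_consS.
Qed.

Lemma rV_unconsK {R : realType} n : cancel (@rV_uncons R n) (@rV_cons R n).
Proof.
move=> x; apply/rowP => i; case: (unliftP ord0 i) => [j|] ->.
  by rewrite rV_consS mxE.
by rewrite rV_cons0.
Qed.

Lemma measurable_rV_cons {R : realType} n :
  measurable_fun [set: measurableTypeR R * 'rV[R]_n] (@rV_cons R n).
Proof.
apply: measurable_fun_rVP => i; case: (unliftP ord0 i) => [j|] ->.
  under eq_fun do rewrite rV_consS.
  exact: measurableT_comp (measurable_rV_coord j) measurable_snd.
under eq_fun do rewrite rV_cons0.
exact: measurable_fst.
Qed.

Lemma measurable_rV_uncons {R : realType} n :
  measurable_fun [set: 'rV[R]_n.+1] (@rV_uncons R n).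
Proof.
apply: (@measurable_fun_pair _ _ _ _ (measurableTypeR R) _); first exact: measurable_rV_coord.
apply: measurable_fun_rVP => i; under eq_fun do rewrite mxE.
exact: measurable_rV_coord.
Qed.

(* The product of the one-dimensional Lebesgue measure with a measure on R^n,
   transported to R^(n+1). *)
Section rV_product.
Context {R : realType} (n : nat).
Variable mu : {sigma_finite_measure set 'rV[R]_n -> \bar R}.

Definition rV_product : set 'rV[R]_n.+1 -> \bar R :=
  pushforward (@lebesgue_measure R \x mu)%E (@rV_cons R n).

Let rV_product0 : rV_product set0 = 0%E.
Proof. by rewrite /rV_product /pushforward preimage_set0 measure0. Qed.

Let rV_product_ge0 A : (0 <= rV_product A)%E.
Proof. exact: (measure_ge0 (@lebesgue_measure R \x mu)%E). Qed.

Let preimage_cons A : measurable A -> measurable (@rV_cons R n @^-1` A).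
Proof.
by move=> mA; rewrite -[X in measurable X]setTI; exact: measurable_rV_cons.
Qed.

Let preimage_uncons A : measurable A -> measurable (@rV_uncons R n @^-1` A).
Proof.
by move=> mA; rewrite -[X in measurable X]setTI; exact: measurable_rV_uncons.
Qed.

Let rV_product_sigma_additive : semi_sigma_additive rV_product.
Proof.
move=> F mF tF mUF; rewrite /rV_product /pushforward preimage_bigcup.
apply: measure_semi_sigma_additive.
- by move=> k; exact: preimage_cons.
- apply/trivIsetP => /= i j _ _ ij; rewrite -preimage_setI.
  by move/trivIsetP : tF => /(_ _ _ _ _ ij) ->//; rewrite preimage_set0.
- by rewrite -preimage_bigcup; exact: preimage_cons.
Qed.

HB.instance Definition _ := isMeasure.Build _ _ _ rV_product
  rV_product0 rV_product_ge0 rV_product_sigma_additive.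

Let rV_product_sigma_finite : sigma_finite setT rV_product.
Proof.
have /sigma_finiteP[F [TF ndF Foo]] := sigma_finiteT (@lebesgue_measure R).
have /sigma_finiteP[G [TG ndG Goo]] := sigma_finiteT mu.
exists (fun k => @rV_uncons R n @^-1` (F k `*` G k)).
  rewrite -preimage_bigcup -[LHS](preimage_setT (@rV_uncons R n)).
  congr (_ @^-1` _); rewrite -setXTT TF TG predeqE => -[x y]; split.
    move=> [/= [k _ Fkx] [l _ Gly]]; exists (maxn k l) => //; split.
    - by move: x Fkx; exact/subsetPset/ndF/leq_maxl.
    - by move: y Gly; exact/subsetPset/ndG/leq_maxr.
  by move=> [k _ []/= ? ?]; split; exists k.
move=> k; have [mFk ?] := Foo k; have [mGk ?] := Goo k; split.
  by apply: preimage_uncons; exact: measurableX.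
rewrite /rV_product /pushforward -comp_preimage.
rewrite (_ : _ \o _ = id); last by apply/funext => p /=; rewrite rV_consK.
by rewrite preimage_id product_measure1E// lte_mul_pinfty// ge0_fin_numE.
Qed.

HB.instance Definition _ := Measure_isSigmaFinite.Build _ _ _ rV_product
  rV_product_sigma_finite.

End rV_product.

Fixpoint rV_lebesgue {R : realType} (n : nat) :
    {sigma_finite_measure set 'rV[R]_n -> \bar R} :=
  if n is k.+1 then rV_product (rV_lebesgue k) else \d_(0 : 'rV[R]_0).

(* Lebesgue measure on R^n: a complete measure, whose sigma-algebra is that of
   the Lebesgue measurable sets (the type [lebesgue_rV R n] is convertible to
   ['rV[R]_n]). *)
Definition lebesgue_rV (R : realType) (n : nat) : measurableType _ :=
  caratheodory_type ((@rV_lebesgue R n)^*)%mu.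

Definition lebesgue_measure_rV {R : realType} (n : nat) :
    {measure set (lebesgue_rV R n) -> \bar R} :=
  @completed_measure_extension _ _ _ (@rV_lebesgue R n).

Section joint.
Context {R : realType} {n : nat}.
Implicit Types (a b c d x : 'rV[R]_n) (f : 'rV[R]_n -> R).

Definition box c d : set 'rV[R]_n :=
  [set x | forall i, c 0 i <= x 0 i <= d 0 i].

Definition joint_increment f c d : R :=
  \sum_(e : {ffun 'I_n -> bool})
    (-1) ^+ (n + \sum_i e i)%N *
    f (\row_i (c 0 i + (e i)%:R * (d 0 i - c 0 i))).

Definition joint_quotient f x (h : R) : R :=
  joint_increment f x (\row_i (x 0 i + h)) / h ^+ n.

(* The functions of interest live on [box a b]; they are represented by total
   functions whose values outside of [box a b] are never used. In particular
   the joint derivative is only considered at the points which have a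
   neighborhood included in [box a b]. *)
Definition joint_derivable a b f x : Prop :=
  (box a b)° x /\ cvg (joint_quotient f x h @[h --> 0^'+]).

(* 0 is a default value, taken where the joint derivative does not exist *)
Definition joint_derivative a b f x : R :=
  if `[< joint_derivable a b f x >]
  then lim (joint_quotient f x h @[h --> 0^'+]) else 0.

(* [p i k] is the k-th point of the subdivision of [a_i, b_i], for k <= N *)
Definition grid_partition a b (N : nat) (p : 'I_n -> nat -> R) : Prop :=
  forall i, [/\ p i 0%N = a 0 i, p i N = b 0 i &
    forall k, (k < N)%N -> p i k < p i k.+1].

Definition grid_variation f (N : nat) (p : 'I_n -> nat -> R) : R :=
  \sum_(j : {ffun 'I_n -> 'I_N})
    `|joint_increment f (\row_i p i (j i)) (\row_i p i (j i).+1)|.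

Definition joint_variation a b f : \bar R :=
  ereal_sup [set v | exists N p,
    [/\ (0 < N)%N, grid_partition a b N p & v = (grid_variation f N p)%:E]].

Definition joint_bounded_variation a b f : Prop :=
  (joint_variation a b f < +oo)%E.

Definition joint_absolutely_continuous a b f : Prop :=
  forall e : R, 0 < e -> exists2 delta : R, 0 < delta &
    forall (N : nat) (c d : 'I_N -> 'rV[R]_n),
      (forall k i, c k 0 i <= d k 0 i) ->
      (forall k, box (c k) (d k) `<=` box a b) ->
      (forall k l, k != l ->
        (box (c k) (d k))° `&` (box (c l) (d l))° = set0) ->
      (\sum_(k < N) lebesgue_measure_rV n (box (c k) (d k)) < delta%:E)%E ->
      \sum_(k < N) `|joint_increment f (c k) (d k)| < e.

End joint.

(* Main.v *)
Require Import Defs.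
From mathcomp Require Import all_boot all_order all_algebra.
From mathcomp Require Import all_classical all_reals all_analysis.
From mathcomp Require Import measurable_realfun ring lra.

(** Write [D I] for the joint increment of [f] over a box [I], [m I] for its
    volume, [V] for the total variation, and [D I / m I] for the mean slope.
    The idea is to approximate [f] by functions with a piecewise constant density.

    The sum of [sqrt (m I ^+ 2 + D I ^+ 2)] over the cells of a grid is a length:
    it increases under refinement and is bounded by the volume plus [V].  Choose
    a grid whose length is almost maximal.  Refining it gains almost no length,
    so the vectors (volume, increment) of the pieces of a cell are almost
    parallel, that is, their increments are almost [s] times their volumes, [s]
    being the mean slope of the cell.  This holds in the sense of variation,
    summed over the good cells, those where the modulus of [s] is at most [M]
    ([flat_grid]); the other cells have a total volume of at most [V / M].
    Hence, by a Vitali covering argument ([packing_cover]), outside of a set of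
    small measure the quotients of increments at a point of a good cell are
    eventually close to [s] ([flat_derivative]).  It follows that the joint
    derivative exists almost everywhere and is close to [s] outside of a small
    set ([derivative_approx]).

    The modulus of [s] integrates over a cell [I] to the modulus of [D I].  So a
    bounded function below the modulus of the derivative has an integral of at
    most the sum of the moduli of [D I] over the cells, up to an arbitrarily small
    error; this bounds the integral of the derivative by [V].  The same argument
    applied outside of a nonoverlapping family of boxes of small volume shows
    that these boxes carry little variation when the integral is equal to [V],
    which is absolute continuity ([integral_simple_le],
    [absolutely_continuous_integral]).  Conversely, if [f] is absolutely
    continuous then the bad cells carry little variation, so the good ones carry
    almost all of [V], and the integral of the derivative is at least their
    variation, up to a small error ([integral_derivative_ge]). *)

Set Implicit Arguments.
Unset Strict Implicit.
Unset Printing Implicit Defensive.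

Import Order.TTheory GRing.Theory Num.Theory.
Import numFieldNormedType.Exports.

Local Open Scope classical_set_scope.
Local Open Scope ring_scope.

(** * Joint increments *)

Section increments.
Context {R : realType} {n : nat}.
Implicit Types (a b c d x : 'rV[R]_n) (f : 'rV[R]_n -> R).
Implicit Types (N : nat) (p q : 'I_n -> nat -> R).

(** The volume is the joint increment of the product of the coordinates, which
    makes it additive for the same reason as any joint increment. *)
Definition volume c d : R := \prod_i (d 0 i - c 0 i).

Lemma sign_cube (e : {ffun 'I_n -> bool}) :
  (-1) ^+ (n + \sum_i e i)%N = \prod_i (-1) ^+ (e i).+1 :> R.
Proof.
rewrite prodrXr; congr (_ ^+ _).
under [RHS]eq_bigr do rewrite -add1n.
by rewrite big_split/= sum1_card card_ord.
Qed.

Lemma joint_increment_prod (g : 'I_n -> R -> R) c d :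
  joint_increment (fun x => \prod_i g i (x 0 i)) c d =
  \prod_i (g i (d 0 i) - g i (c 0 i)).
Proof.
rewrite /joint_increment.
transitivity (\prod_i \sum_(e : bool)
    ((-1) ^+ e.+1 * g i (c 0 i + e%:R * (d 0 i - c 0 i)))).
  rewrite bigA_distr_bigA/=; apply: eq_bigr => e _.
  by rewrite sign_cube -big_split/=; apply: eq_bigr => i _; rewrite mxE.
apply: eq_bigr => i _; rewrite big_bool/= mul1r mul0r addr0 [c 0 i + _]addrC subrK.
by rewrite expr1 sqrrN expr1n mulN1r mul1r.
Qed.

Lemma joint_increment_volume c d :
  joint_increment (fun x => \prod_i x 0 i) c d = volume c d.
Proof. exact: (joint_increment_prod (fun _ t => t)). Qed.

(** A function on a finite lattice of points is a combination of indicators of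
    points, each of which is a product of functions of one index; so its joint
    increments are combinations of products of one-variable increments. *)
Lemma joint_increment_lattice f N p (l h : 'I_n -> 'I_N.+1) :
  joint_increment f (\row_i p i (l i)) (\row_i p i (h i)) =
  \sum_(k : {ffun 'I_n -> 'I_N.+1}) f (\row_i p i (k i)) *
    \prod_i ((h i == k i)%:R - (l i == k i)%:R).
Proof.
transitivity (\sum_(k : {ffun 'I_n -> 'I_N.+1}) f (\row_i p i (k i)) *
  \sum_(e : {ffun 'I_n -> bool}) ((-1) ^+ (n + \sum_i e i)%N *
    \prod_i ((if e i then h i else l i) == k i)%:R)).
  under [RHS]eq_bigr do rewrite mulr_sumr.
  rewrite exchange_big/=; apply: eq_bigr => e _.
  rewrite (bigD1 [ffun i => if e i then h i else l i])//= [X in _ + X]big1.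
    rewrite addr0 [X in _ * (_ * X)]big1 ?mulr1 => [|i _]; last by rewrite ffunE eqxx.
    rewrite mulrC; congr (f _ * _); apply/rowP => i.
    by rewrite !mxE ffunE; case: (e i); rewrite ?mul1r ?mul0r ?addr0// addrC subrK.
  move=> k /eqP kE; apply/eqP; rewrite mulf_eq0; apply/orP; right.
  rewrite mulf_eq0; apply/orP; right; apply/prodf_eq0.
  have [i /eqP ki] : exists i, (if e i then h i else l i) <> k i.
    by apply/existsNP => H; apply: kE; apply/ffunP => i; rewrite ffunE H.
  by exists i => //; rewrite pnatr_eq0 eqb0.
apply: eq_bigr => k _; congr (_ * _).
transitivity (\prod_i \sum_(e : bool)
    ((-1) ^+ e.+1 * ((if e then h i else l i) == k i)%:R) : R).
  rewrite bigA_distr_bigA/=; apply: eq_bigr => e _.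
  by rewrite sign_cube -big_split.
by apply: eq_bigr => i _; rewrite big_bool/= expr1 sqrrN expr1n mulN1r mul1r.
Qed.

Definition subcell (l h : 'I_n -> nat) N (j : {ffun 'I_n -> 'I_N}) :=
  [forall i, (l i <= j i < h i)%N].

Definition cell_lo p N (j : {ffun 'I_n -> 'I_N}) : 'rV[R]_n := \row_i p i (j i).
Definition cell_hi p N (j : {ffun 'I_n -> 'I_N}) : 'rV[R]_n :=
  \row_i p i (j i).+1.

(** Additivity of the joint increment.  By the lattice formula it is enough to
    know it for products, where it is the product over the axes of telescoping
    sums. *)
Lemma joint_increment_subcells f N p (l h : 'I_n -> nat) :
  (forall i, l i <= h i)%N -> (forall i, h i <= N)%N ->
  joint_increment f (\row_i p i (l i)) (\row_i p i (h i)) =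
  \sum_(j : {ffun 'I_n -> 'I_N} | subcell l h j)
    joint_increment f (cell_lo p j) (cell_hi p j).
Proof.
move=> lh hN.
have lN i : (l i <= N)%N by exact: leq_trans (lh i) (hN i).
pose lift (u : 'I_n -> nat) i : 'I_N.+1 := inord (u i).
have liftE (u : 'I_n -> nat) : (forall i, u i <= N)%N ->
    \row_i p i (u i) = \row_i p i (lift u i) :> 'rV[R]_n.
  by move=> uN; apply/rowP => i; rewrite !mxE inordK// ltnS.
rewrite (liftE _ lN) (liftE _ hN) joint_increment_lattice.
under [RHS]eq_bigr => j _.
  rewrite /cell_lo /cell_hi (liftE (fun i => j i)); last by move=> i; exact: ltnW.
  rewrite (liftE (fun i => (j i).+1)); last by move=> i; exact: ltn_ord.
  rewrite joint_increment_lattice; over.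
rewrite exchange_big/=; apply: eq_bigr => k _; rewrite -mulr_sumr.
congr (_ * _).
pose F i (m : nat) : R := (m == k i :> nat)%:R.
have liftk (u : 'I_n -> nat) i : (u i <= N)%N ->
    (lift u i == k i)%:R = F i (u i) :> R.
  by move=> uN; rewrite /F -val_eqE /= inordK.
transitivity (\prod_i \sum_(m : 'I_N | (l i <= m < h i)%N) (F i m.+1 - F i m)).
  apply: eq_bigr => i _; rewrite !liftk//.
  rewrite -(@telescope_sumr _ (l i) (h i) (F i)); last exact: lh.
  rewrite -(big_mkord (fun m => l i <= m < h i)%N (fun m => F i m.+1 - F i m)).
  rewrite (big_nat_widenl (l i) 0)// (big_nat_widen 0 (h i) N)//.
rewrite (bigA_distr_big_dep (fun i (m : 'I_N) => (l i <= m < h i)%N)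
  (fun i (m : 'I_N) => F i m.+1 - F i m)) /=.
rewrite [LHS](eq_bigl (fun j => subcell l h j)) => [|j].
  apply: eq_bigr => j _; apply: eq_bigr => i _.
  by rewrite (liftk (fun i => (j i).+1))// (liftk (fun i => j i))// ltnW.
by rewrite /subcell; apply/familyP/forallP => H i; have := H i.
Qed.

End increments.
(** * Grids *)

Section grids.
Context {R : realType} {n : nat}.
Implicit Types (a b c d u v x : 'rV[R]_n) (f : 'rV[R]_n -> R).
Implicit Types (N : nat) (p q : 'I_n -> nat -> R).

Definition subbox c d c' d' : bool :=
  [forall i, (c' 0 i <= c 0 i) && (d 0 i <= d' 0 i)].

(** Each coordinate of [x] is a cut of the grid on the corresponding axis; a box
    with two such corners is a union of cells. *)
Definition adapted N p x : Prop :=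
  forall i, exists2 k, (k <= N)%N & p i k = x 0 i.

(** Order-theoretic form of the disjointness of interiors: it is what prevents
    a cell of a grid from lying in both boxes. *)
Definition nonoverlapping c d c' d' : Prop :=
  forall u v, (forall i, u 0 i < v 0 i) ->
    subbox u v c d -> subbox u v c' d' -> False.

Lemma subboxP c d c' d' :
  reflect (forall i, c' 0 i <= c 0 i /\ d 0 i <= d' 0 i) (subbox c d c' d').
Proof. by apply: (iffP forallP) => H i; apply/andP/H. Qed.

Lemma subbox_trans c d c' d' c'' d'' :
  subbox c d c' d' -> subbox c' d' c'' d'' -> subbox c d c'' d''.
Proof.
move=> /subboxP H /subboxP H'; apply/subboxP => i.
have [h1 h2] := H i; have [h3 h4] := H' i.
by split; [exact: le_trans h1|exact: le_trans h4].
Qed.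

Lemma box_subbox c d c' d' : subbox c d c' d' -> box c d `<=` box c' d'.
Proof.
move=> /subboxP H x xcd i; have [h1 h2] := H i; have /andP[h3 h4] := xcd i.
by rewrite (le_trans h1 h3) (le_trans h4 h2).
Qed.

Lemma cell_loE p N (j : {ffun 'I_n -> 'I_N}) i : cell_lo p j 0 i = p i (j i).
Proof. by rewrite mxE. Qed.

Lemma cell_hiE p N (j : {ffun 'I_n -> 'I_N}) i : cell_hi p j 0 i = p i (j i).+1.
Proof. by rewrite mxE. Qed.

Section one_grid.
Variables (a b : 'rV[R]_n) (N : nat) (p : 'I_n -> nat -> R).
Hypothesis gridp : grid_partition a b N p.

Lemma grid_lt i k l : (k < l)%N -> (l <= N)%N -> p i k < p i l.
Proof.
have [_ _ inc] := gridp i; elim: l => // l IH; rewrite ltnS leq_eqVlt.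
move=> /predU1P[->|kl] lN; first exact: inc.
by rewrite (lt_trans _ (inc _ lN))// IH// ltnW.
Qed.

Lemma grid_le i k l : (k <= l)%N -> (l <= N)%N -> p i k <= p i l.
Proof.
by rewrite leq_eqVlt => /predU1P[->//|kl] lN; rewrite ltW// grid_lt.
Qed.

Lemma grid_leE i k l : (k <= N)%N -> (l <= N)%N -> (p i k <= p i l) = (k <= l)%N.
Proof.
move=> kN lN; have [kl|lk] := leqP k l; first exact: grid_le.
by apply/negbTE; rewrite -ltNge grid_lt.
Qed.

Lemma cell_lt (j : {ffun 'I_n -> 'I_N}) i : cell_lo p j 0 i < cell_hi p j 0 i.
Proof. by rewrite cell_loE cell_hiE grid_lt. Qed.

Lemma cell_subbox (j : {ffun 'I_n -> 'I_N}) :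
  subbox (cell_lo p j) (cell_hi p j) a b.
Proof.
apply/subboxP => i; rewrite cell_loE cell_hiE.
by have [<- <- _] := gridp i; rewrite !grid_le// ltnW.
Qed.

Lemma grid_adapted_lo : adapted N p a.
Proof. by move=> i; exists 0%N => //; have [] := gridp i. Qed.

Lemma grid_adapted_hi : adapted N p b.
Proof. by move=> i; exists N => //; have [] := gridp i. Qed.

Lemma joint_increment_cells f c d : adapted N p c -> adapted N p d ->
  (forall i, c 0 i <= d 0 i) ->
  joint_increment f c d =
  \sum_(j : {ffun 'I_n -> 'I_N} | subbox (cell_lo p j) (cell_hi p j) c d)
    joint_increment f (cell_lo p j) (cell_hi p j).
Proof.
move=> pc pd cd.
have /choice[l lP] : forall i, exists k, (k <= N)%N /\ p i k = c 0 i.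
  by move=> i; have [k kN pk] := pc i; exists k.
have /choice[h hP] : forall i, exists k, (k <= N)%N /\ p i k = d 0 i.
  by move=> i; have [k kN pk] := pd i; exists k.
have lE : c = \row_i p i (l i) by apply/rowP => i; rewrite mxE (lP i).2.
have hE : d = \row_i p i (h i) by apply/rowP => i; rewrite mxE (hP i).2.
rewrite [in LHS]lE [in LHS]hE (@joint_increment_subcells _ _ _ N).
- apply: eq_bigl => j; apply/forallP/forallP => H i; have := H i.
  + move=> /andP[lj jh]; rewrite cell_loE cell_hiE -(lP i).2 -(hP i).2.
    by rewrite !grid_le//; [exact: (hP i).1|exact: ltnW].
  + rewrite cell_loE cell_hiE -(lP i).2 -(hP i).2 !grid_leE//.
    * exact: (hP i).1.
    * exact: (lP i).1.
    * exact: ltnW.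
- by move=> i; rewrite -(grid_leE i (lP i).1 (hP i).1) (lP i).2 (hP i).2.
- by move=> i; exact: (hP i).1.
Qed.

Lemma joint_increment_grid f : (forall i, a 0 i <= b 0 i) ->
  joint_increment f a b = \sum_(j : {ffun 'I_n -> 'I_N})
    joint_increment f (cell_lo p j) (cell_hi p j).
Proof.
move=> ab; rewrite (joint_increment_cells f grid_adapted_lo grid_adapted_hi ab).
by apply: eq_bigl => j; rewrite cell_subbox.
Qed.

Lemma cells_nonoverlapping (j k : {ffun 'I_n -> 'I_N}) : j != k ->
  nonoverlapping (cell_lo p j) (cell_hi p j) (cell_lo p k) (cell_hi p k).
Proof.
move=> /eqP jk u v uv /subboxP uvj /subboxP uvk; apply: jk.
apply/ffunP => i; apply/val_inj => /=.
have [+ +] := uvj i; have [+ +] := uvk i; rewrite !cell_loE !cell_hiE.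
move=> h1 h2 h3 h4.
have := lt_le_trans (le_lt_trans h1 (uv i)) h4.
have := lt_le_trans (le_lt_trans h3 (uv i)) h2.
rewrite !ltNge !grid_leE//; try exact: ltnW.
by rewrite -!ltnNge !ltnS => ? ?; apply/eqP; rewrite eqn_leq; apply/andP.
Qed.

(** A cell of the grid lies in at most one box of a nonoverlapping family. *)
Lemma sum_nonoverlapping (K : finType) (c d : K -> 'rV[R]_n)
    (X : {ffun 'I_n -> 'I_N} -> R) :
  (forall k l, k != l -> nonoverlapping (c k) (d k) (c l) (d l)) ->
  (forall j, 0 <= X j) ->
  \sum_k \sum_(j | subbox (cell_lo p j) (cell_hi p j) (c k) (d k)) X j <=
  \sum_(j | [exists k, subbox (cell_lo p j) (cell_hi p j) (c k) (d k)]) X j.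
Proof.
move=> cd X0; rewrite (exchange_big_dep (fun j => [exists k,
  subbox (cell_lo p j) (cell_hi p j) (c k) (d k)]))/=; last first.
  by move=> k j _ jk; apply/existsP; exists k.
apply: ler_sum => j /existsP[k jk]; rewrite (bigD1 k)//= big_pred0 ?addr0// => l.
apply/negbTE/negP => /andP[jl lk].
exact: (cd _ _ lk _ _ (cell_lt j) jl jk).
Qed.

Lemma sum_nonoverlapping_le (K : finType) (c d : K -> 'rV[R]_n)
    (X : {ffun 'I_n -> 'I_N} -> R) :
  (forall k l, k != l -> nonoverlapping (c k) (d k) (c l) (d l)) ->
  (forall j, 0 <= X j) ->
  \sum_k \sum_(j | subbox (cell_lo p j) (cell_hi p j) (c k) (d k)) X j <=
  \sum_j X j.
Proof.
move=> cd X0; apply: le_trans (sum_nonoverlapping cd X0) _.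
by rewrite [leRHS](bigID (fun j => [exists k,
  subbox (cell_lo p j) (cell_hi p j) (c k) (d k)]))/= lerDl sumr_ge0.
Qed.

Lemma box_cell x : (0 < N)%N -> (forall i, a 0 i <= x 0 i < b 0 i) ->
  exists j : {ffun 'I_n -> 'I_N}, forall i, p i (j i) <= x 0 i < p i (j i).+1.
Proof.
move=> N0 xab.
have /choice[j jP] : forall i, exists k : 'I_N, p i k <= x 0 i < p i k.+1.
  move=> i; have [p0 pN _] := gridp i; have /andP[ax xb] := xab i.
  have ex : exists k, (k < N)%N && (p i k <= x 0 i) by exists 0%N; rewrite N0 p0.
  have ub k : (k < N)%N && (p i k <= x 0 i) -> (k <= N)%N.
    by move=> /andP[/ltnW].
  case: (ex_maxnP ex ub) => k /andP[kN pk] kmax; exists (Ordinal kN) => /=.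
  rewrite pk/= ltNge; apply/negP => pk1.
  have [k1N|] := ltnP k.+1 N.
    by have := kmax k.+1; rewrite k1N pk1 ltnn; move=> /(_ isT).
  move=> Nk; have kE : k.+1 = N by apply/eqP; rewrite eqn_leq kN Nk.
  by move: pk1; rewrite kE pN leNgt xb.
by exists (finfun j) => i; rewrite ffunE.
Qed.

End one_grid.

Definition refines N q N0 p :=
  forall i k, (k <= N0)%N -> exists2 l, (l <= N)%N & q i l = p i k.

Lemma refines_cell N q N0 p (j : {ffun 'I_n -> 'I_N0}) : refines N q N0 p ->
  adapted N q (cell_lo p j) /\ adapted N q (cell_hi p j).
Proof.
by move=> qp; split=> i; rewrite ?cell_loE ?cell_hiE; apply: qp => //; exact: ltnW.
Qed.

(** The same number of cuts is required on all the axes; this fills up the axes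
    with fewer prescribed cuts. *)
Lemma extend_uniq (u v : R) (s : seq R) m : u < v -> uniq s ->
  (forall t, t \in s -> u <= t <= v) ->
  exists t, [/\ size t = (m + size s)%N, uniq t, {subset s <= t} &
    forall r, r \in t -> u <= r <= v].
Proof.
move=> uv us suv; elim: m => [|m [t [szt ut st tuv]]]; first by exists s; split.
pose g k := u + (v - u) / k.+1%:R.
have guv k : u <= g k <= v.
  have vu : 0 <= v - u by rewrite subr_ge0 ltW.
  rewrite /g lerDl divr_ge0//= -lerBrDl ler_pdivrMr// ler_peMr//.
  by rewrite ler1n.
have ginj : injective g.
  move=> k l /addrI; have /mulfI inj : v - u != 0 by rewrite subr_eq0 gt_eqF.
  by move=> /inj /invr_inj /eqP; rewrite eqr_nat => /eqP[].
have [k gk] : exists k, g k \notin t.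
  apply/not_existsP => H.
  have : (size (map g (iota 0 (size t).+1)) <= size t)%N.
    apply: uniq_leq_size; first by rewrite map_inj_uniq// iota_uniq.
    by move=> _ /mapP[k _ ->]; apply/negPn/negP/H.
  by rewrite size_map size_iota ltnn.
exists (g k :: t); split => /=.
- by rewrite szt.
- by rewrite gk ut.
- by move=> r /st rt; rewrite in_cons rt orbT.
- by move=> r; rewrite in_cons => /predU1P[->|/tuv].
Qed.

Lemma sorted_subdivision (u v : R) (s : seq R) N : u < v ->
  (forall t, t \in s -> u <= t <= v) -> (size s < N)%N ->
  exists g : nat -> R, [/\ g 0%N = u, g N = v,
    forall k, (k < N)%N -> g k < g k.+1 &
    forall t, t \in s -> exists2 k, (k <= N)%N & g k = t].
Proof.
move=> uv suv szs.
have szu : (size (undup (u :: v :: s)) <= N.+1)%N.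
  by apply: leq_trans (size_undup _) _.
have [||t [szt ut st tuv]] :=
    @extend_uniq u v (undup (u :: v :: s)) (N.+1 - size (undup (u :: v :: s))) uv.
- exact: undup_uniq.
- move=> t; rewrite mem_undup !inE => /or3P[/eqP->|/eqP->|/suv//].
  + by rewrite lexx ltW.
  + by rewrite lexx ltW.
rewrite subnK// in szt.
pose w := sort <=%O t.
have wt : w =i t by move=> x; rewrite mem_sort.
have szw : size w = N.+1 by rewrite size_sort.
have sw : sorted <%O w by rewrite sort_lt_sorted.
have inc k l : (k < l)%N -> (l <= N)%N -> nth u w k < nth u w l.
  move=> kl lN; apply: (sorted_ltn_nth lt_trans) => //; rewrite inE szw ltnS//.
  exact: ltnW (leq_trans kl lN).
have ind r : r \in w -> exists2 k, (k <= N)%N & nth u w k = r.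
  by move=> rw; exists (index r w); [rewrite -ltnS -szw index_mem|exact: nth_index].
have bnd k : (k <= N)%N -> u <= nth u w k <= v.
  by move=> kN; apply: tuv; rewrite -wt mem_nth// szw.
have mem r : r \in u :: v :: s -> r \in w.
  by rewrite wt => rs; apply: st; rewrite mem_undup.
exists (nth u w); split.
- have [k kN kE] := ind _ (mem u (mem_head _ _)).
  apply/eqP; rewrite eq_le (andP (bnd _ (leq0n N))).1 andbT.
  by case: k kN kE => [_ ->//|k kN {2}<-]; exact/ltW/inc.
- have [|k kN kE] := ind v; first by apply: mem; rewrite !inE eqxx orbT.
  apply/eqP; rewrite eq_le (andP (bnd _ (leqnn N))).2 /=.
  move: kN; rewrite leq_eqVlt => /predU1P[<-|kN]; first by rewrite kE.
  by rewrite -[leLHS]kE; exact/ltW/inc.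
- by move=> k kN; exact: inc.
- by move=> r rs; apply: ind; apply: mem; rewrite !inE rs !orbT.
Qed.

Lemma adapted_grid a b (S : seq 'rV[R]_n) : (forall i, a 0 i < b 0 i) ->
  (forall x, x \in S -> box a b x) ->
  exists N p, [/\ (0 < N)%N, grid_partition a b N p &
    forall x, x \in S -> adapted N p x].
Proof.
move=> ab Sab; exists (size S).+1.
have /choice[p pP] : forall i : 'I_n, exists g : nat -> R, [/\ g 0%N = a 0 i,
    g (size S).+1 = b 0 i, forall k, (k < (size S).+1)%N -> g k < g k.+1 &
    forall t, t \in [seq x 0 i | x : 'rV[R]_n <- S] ->
      exists2 k, (k <= (size S).+1)%N & g k = t].
  move=> i; apply: sorted_subdivision => //; last by rewrite size_map.
  by move=> _ /mapP[x /Sab xab ->]; exact: xab.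
exists p; split => //; first by move=> i; have [? ? ? _] := pP i; split.
by move=> x xS i; have [_ _ _] := pP i; apply; exact: map_f.
Qed.

Lemma exists_grid a b : (forall i, a 0 i < b 0 i) ->
  exists N p, (0 < N)%N /\ grid_partition a b N p.
Proof.
move=> ab; have [//|N [p [N0 gp _]]] := @adapted_grid a b [::] ab.
by exists N, p.
Qed.

Definition grid_points N p : seq 'rV[R]_n := [seq \row_i p i k | k <- iota 0 N.+1].

Lemma grid_points_box a b N p x :
  grid_partition a b N p -> x \in grid_points N p -> box a b x.
Proof.
move=> gp /mapP[k kN ->] i; rewrite mxE.
have [<- <- _] := gp i; move: kN; rewrite mem_iota ltnS /= => kN.
by rewrite !(grid_le gp).
Qed.

Lemma grid_points_refines N q N0 p :
  (forall x, x \in grid_points N0 p -> adapted N q x) -> refines N q N0 p.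
Proof.
move=> qp i k kN; have := qp (\row_i p i k).
rewrite map_f; last by rewrite mem_iota ltnS.
by move=> /(_ isT i); rewrite mxE.
Qed.

Lemma refining_grid a b N0 p0 (S : seq 'rV[R]_n) : (forall i, a 0 i < b 0 i) ->
  grid_partition a b N0 p0 -> (forall x, x \in S -> box a b x) ->
  exists N p, [/\ (0 < N)%N, grid_partition a b N p, refines N p N0 p0 &
    forall x, x \in S -> adapted N p x].
Proof.
move=> ab g0 Sab.
have [|N [p [N_gt0 gp pS]]] := @adapted_grid a b (grid_points N0 p0 ++ S) ab.
  by move=> x; rewrite mem_cat => /orP[/(grid_points_box g0)|/Sab].
exists N, p; split => //.
  by apply: grid_points_refines => x xp; apply: pS; rewrite mem_cat xp.
by move=> x xS; apply: pS; rewrite mem_cat xS orbT.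
Qed.

End grids.
(** * Variation and length of grids *)

Section variation.
Context {R : realType} {n : nat}.
Implicit Types (a b c d u v x : 'rV[R]_n).
Implicit Types (N : nat) (p q : 'I_n -> nat -> R).

(** Cauchy-Schwarz against the unit vector of slope [s]; it gives the triangle
    inequality for the lengths [sqrt (m ^+ 2 + D ^+ 2)] below. *)
Lemma projection_le_norm (s m D : R) :
  (m + s * D) / Num.sqrt (1 + s ^+ 2) <= Num.sqrt (m ^+ 2 + D ^+ 2).
Proof.
have L0 : 0 < 1 + s ^+ 2 by rewrite ltr_pwDl// sqr_ge0.
rewrite ler_pdivrMr ?sqrtr_gt0// -sqrtrM ?addr_ge0 ?sqr_ge0//.
apply: le_trans (ler_norm _) _; rewrite -sqrtr_sqr ler_sqrt.
  by have := sqr_ge0 (s * m - D); nra.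
by rewrite mulr_ge0 ?addr_ge0 ?sqr_ge0// ltW.
Qed.

(** Let [t] be the component of [(m, D)] along the unit vector of slope [s] and
    [w] the orthogonal one, so that [D - s * m = L * w].  Then
    [w ^+ 2 = (r - t) * (r + t) <= 2 * r * (r - t)], and the geometric mean is
    split with the weight [theta].  When the vectors [(m, D)] of the cells of a
    box add up to a vector of slope [s], the sum of the [r - t] is the length
    gained by subdividing the box. *)
Lemma orthogonal_le (s m D theta : R) (L := Num.sqrt (1 + s ^+ 2))
    (r := Num.sqrt (m ^+ 2 + D ^+ 2)) : 0 < theta ->
  `|D - s * m| <= L * (theta * r + (r - (m + s * D) / L) / theta).
Proof.
move=> th0.
have L0 : 0 < L by rewrite sqrtr_gt0 ltr_pwDl// sqr_ge0.
have L2 : L ^+ 2 = 1 + s ^+ 2 by rewrite sqr_sqrtr// addr_ge0// sqr_ge0.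
have r0 : 0 <= r by exact: sqrtr_ge0.
have r2 : r ^+ 2 = m ^+ 2 + D ^+ 2 by rewrite sqr_sqrtr// addr_ge0// sqr_ge0.
have := projection_le_norm s m D; rewrite -/L -/r.
set t := _ / L => tr.
have tL : t * L = m + s * D by rewrite divfK// gt_eqF.
set w := (D - s * m) / L.
have wL : w * L = D - s * m by rewrite divfK// gt_eqF.
have tw : t ^+ 2 + w ^+ 2 = r ^+ 2.
  have /mulIf : L ^+ 2 != 0 by rewrite expf_neq0// gt_eqF.
  by apply; rewrite mulrDl r2 -!exprMn tL wL L2; ring.
rewrite -wL normrM (gtr0_norm L0) mulrC ler_pM2l//.
set q := (r - t) / theta.
have qth : q * theta = r - t by rewrite divfK// gt_eqF.
have q0 : 0 <= q by rewrite divr_ge0 ?subr_ge0// ltW.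
have y0 : 0 <= theta * r + q by rewrite addr_ge0// mulr_ge0// ltW.
rewrite -(ler_pXn2r (ltn0Sn 1))// ?nnegrE// real_normK ?num_real//.
have -> : w ^+ 2 = (r - t) * (r + t).
  by rewrite -[w ^+ 2](addrK (t ^+ 2)) [w ^+ 2 + _]addrC tw; ring.
rewrite -qth.
have h1 : q * theta * (r + t) <= q * theta * (2 * r).
  by rewrite ler_wpM2l// ?qth ?subr_ge0//; lra.
apply: le_trans h1 _; have := sqr_ge0 (theta * r); have := sqr_ge0 q; nra.
Qed.

Variables (a b : 'rV[R]_n) (f : 'rV[R]_n -> R).
Hypothesis ab : forall i, a 0 i < b 0 i.

Definition mean_slope c d : R := joint_increment f c d / volume c d.

(** Norm of the vector measure (volume, increment) on a box.  The sum of these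
    norms over a grid increases under refinement and is bounded for functions
    of bounded variation; being strictly convex in the slope, unlike the
    variation, it detects the oscillation of the mean slopes. *)
Definition box_length c d : R :=
  Num.sqrt (volume c d ^+ 2 + joint_increment f c d ^+ 2).

Definition grid_length N p : R :=
  \sum_(j : {ffun 'I_n -> 'I_N}) box_length (cell_lo p j) (cell_hi p j).

Lemma volume_gt0 c d : (forall i, c 0 i < d 0 i) -> 0 < volume c d.
Proof. by move=> cd; apply: prodr_gt0 => i _; rewrite subr_gt0. Qed.

Lemma volume_ge0 c d : (forall i, c 0 i <= d 0 i) -> 0 <= volume c d.
Proof. by move=> cd; apply: prodr_ge0 => i _; rewrite subr_ge0. Qed.

Lemma volume_cells N p c d : grid_partition a b N p ->
  adapted N p c -> adapted N p d -> (forall i, c 0 i <= d 0 i) ->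
  volume c d =
  \sum_(j : {ffun 'I_n -> 'I_N} | subbox (cell_lo p j) (cell_hi p j) c d)
    volume (cell_lo p j) (cell_hi p j).
Proof.
move=> gp pc pd cd; rewrite -joint_increment_volume.
rewrite (joint_increment_cells gp _ pc pd cd).
by apply: eq_bigr => j _; rewrite joint_increment_volume.
Qed.

Lemma volume_grid N p : grid_partition a b N p ->
  volume a b = \sum_(j : {ffun 'I_n -> 'I_N}) volume (cell_lo p j) (cell_hi p j).
Proof.
move=> gp; rewrite -joint_increment_volume (joint_increment_grid gp) => [|i].
  by apply: eq_bigr => j _; rewrite joint_increment_volume.
exact: ltW.
Qed.

Lemma norm_increment_cells N p c d : grid_partition a b N p ->
  adapted N p c -> adapted N p d -> (forall i, c 0 i <= d 0 i) ->
  `|joint_increment f c d| <=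
  \sum_(j : {ffun 'I_n -> 'I_N} | subbox (cell_lo p j) (cell_hi p j) c d)
    `|joint_increment f (cell_lo p j) (cell_hi p j)|.
Proof.
move=> gp pc pd cd; rewrite (joint_increment_cells gp f pc pd cd).
exact: ler_norm_sum.
Qed.

Lemma grid_variation_refines N q N0 p : grid_partition a b N q ->
  grid_partition a b N0 p -> refines N q N0 p ->
  grid_variation f N0 p <= grid_variation f N q.
Proof.
move=> gq gp qp.
apply: le_trans (sum_nonoverlapping_le gq (cells_nonoverlapping gp)
  (fun j => normr_ge0 (joint_increment f (cell_lo q j) (cell_hi q j)))).
apply: ler_sum => j _; apply: norm_increment_cells => //.
- exact: (refines_cell j qp).1.
- exact: (refines_cell j qp).2.
- by move=> i; exact/ltW/(cell_lt gp).
Qed.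

Lemma mean_slope_sqrt c d : (forall i, c 0 i < d 0 i) ->
  volume c d * Num.sqrt (1 + mean_slope c d ^+ 2) = box_length c d.
Proof.
move=> /volume_gt0 v0; rewrite /box_length -{1}(gtr0_norm v0) -sqrtr_sqr.
rewrite -sqrtrM ?sqr_ge0// mulrDr mulr1 -exprMn /mean_slope mulrC divfK//.
by rewrite gt_eqF.
Qed.

(** The cells of a box contribute to its length through their components along
    the direction of its own vector (volume, increment). *)
Lemma box_length_projection N q c d : grid_partition a b N q ->
  adapted N q c -> adapted N q d -> (forall i, c 0 i < d 0 i) ->
  box_length c d =
  \sum_(j : {ffun 'I_n -> 'I_N} | subbox (cell_lo q j) (cell_hi q j) c d)
    (volume (cell_lo q j) (cell_hi q j) + mean_slope c d *
      joint_increment f (cell_lo q j) (cell_hi q j)) /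
    Num.sqrt (1 + mean_slope c d ^+ 2).
Proof.
move=> gq qc qd cd; have cd' i : c 0 i <= d 0 i by exact: ltW.
rewrite -mulr_suml big_split/= -mulr_sumr.
rewrite -(volume_cells gq qc qd cd') -(joint_increment_cells gq f qc qd cd').
rewrite -mean_slope_sqrt//; set s := mean_slope c d.
have s0 : 0 < 1 + s ^+ 2 by rewrite ltr_pwDl// sqr_ge0.
have -> : joint_increment f c d = s * volume c d.
  by rewrite divfK// gt_eqF// volume_gt0.
have -> : volume c d + s * (s * volume c d) = volume c d * (1 + s ^+ 2) by ring.
set L := Num.sqrt _; have L2 : L * L = 1 + s ^+ 2 by rewrite -expr2 sqr_sqrtr// ltW.
by rewrite -L2 mulrA mulfK// gt_eqF// sqrtr_gt0.
Qed.

Lemma box_length_cells N q c d : grid_partition a b N q ->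
  adapted N q c -> adapted N q d -> (forall i, c 0 i < d 0 i) ->
  box_length c d <=
  \sum_(j : {ffun 'I_n -> 'I_N} | subbox (cell_lo q j) (cell_hi q j) c d)
    box_length (cell_lo q j) (cell_hi q j).
Proof.
move=> gq qc qd cd; rewrite (box_length_projection gq qc qd cd).
by apply: ler_sum => j _; exact: projection_le_norm.
Qed.

Lemma grid_length_refines N q N0 p : grid_partition a b N q ->
  grid_partition a b N0 p -> refines N q N0 p ->
  grid_length N0 p <= grid_length N q.
Proof.
move=> gq gp qp.
apply: le_trans (sum_nonoverlapping_le gq (cells_nonoverlapping gp)
  (fun j => sqrtr_ge0 _)).
apply: ler_sum => j _; apply: box_length_cells => //.
- exact: (refines_cell j qp).1.
- exact: (refines_cell j qp).2.
- by move=> i; exact: cell_lt.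
Qed.

Variable V : R.
Hypothesis fV : forall N p, (0 < N)%N -> grid_partition a b N p ->
  grid_variation f N p <= V.

Lemma variation_bound_ge0 : 0 <= V.
Proof.
have [N [p [N0 gp]]] := exists_grid ab.
by apply: le_trans (fV N0 gp); exact: sumr_ge0.
Qed.

Lemma grid_length_le N p : (0 < N)%N -> grid_partition a b N p ->
  grid_length N p <= volume a b + V.
Proof.
move=> N0 gp; apply: le_trans (lerD (lexx _) (fV N0 gp)).
rewrite (volume_grid gp) -big_split/=; apply: ler_sum => j _.
have v0 : 0 <= volume (cell_lo p j) (cell_hi p j).
  by apply: volume_ge0 => i; exact/ltW/(cell_lt gp).
rewrite -[leRHS]ger0_norm ?addr_ge0// -sqrtr_sqr ler_sqrt ?sqr_ge0//.
rewrite sqrrD real_normK ?num_real// lerD2r lerDl.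
by rewrite mulrn_wge0// mulr_ge0.
Qed.

(** The other cells have a total volume of at most [V / M]. *)
Definition good_cell (M : R) N p (j : {ffun 'I_n -> 'I_N}) : bool :=
  `|mean_slope (cell_lo p j) (cell_hi p j)| <= M.

(** Under every refinement, [f] stays close in variation, on the good cells, to
    the function with constant density [mean_slope] on each cell. *)
Definition flat (M kappa : R) N p : Prop :=
  forall N' q, (0 < N')%N -> grid_partition a b N' q -> refines N' q N p ->
    \sum_(j : {ffun 'I_n -> 'I_N} | good_cell M p j)
      \sum_(k : {ffun 'I_n -> 'I_N'} | subbox (cell_lo q k) (cell_hi q k)
          (cell_lo p j) (cell_hi p j))
        `|joint_increment f (cell_lo q k) (cell_hi q k) -
          mean_slope (cell_lo p j) (cell_hi p j) *
            volume (cell_lo q k) (cell_hi q k)| <= kappa.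

(** Take a grid whose length is within [eta] of the supremum.  A refinement gains
    at most [eta], which by [orthogonal_le] controls the deviation of the
    increments from the mean slopes, on the cells whose slope is bounded. *)
Lemma flat_grid (S : seq 'rV[R]_n) (M kappa : R) : 0 < kappa ->
  (forall x, x \in S -> box a b x) ->
  exists N p, [/\ (0 < N)%N, grid_partition a b N p,
    forall x, x \in S -> adapted N p x & flat M kappa N p].
Proof.
move=> kappa0 Sab.
pose E := [set l | exists N p,
  [/\ (0 < N)%N, grid_partition a b N p & l = grid_length N p]].
have [N0 [p0 [N00 gp0]]] := exists_grid ab.
have supE : has_sup E.
  split; first by exists (grid_length N0 p0), N0, p0.
  by exists (volume a b + V) => _ [N [p [N_gt0 gp ->]]]; exact: grid_length_le.
pose B : R := `|sup E| + 1.
have B0 : 0 < B by rewrite ltr_wpDl.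
pose Lam : R := Num.sqrt (1 + M ^+ 2).
have Lam0 : 0 < Lam by rewrite sqrtr_gt0 ltr_pwDl// sqr_ge0.
have [theta thetaE] : exists t, t = kappa / (2 * Lam * B) by eexists.
have theta0 : 0 < theta by rewrite thetaE divr_gt0// !mulr_gt0.
pose eta := theta * kappa / (2 * Lam).
have eta0 : 0 < eta by rewrite divr_gt0// mulr_gt0.
have [_ [N1 [p1 [N10 gp1 ->]]] near] := sup_adherent eta0 supE.
have [N [p [N_gt0 gp pp1 pS]]] := refining_grid ab gp1 Sab.
exists N, p; split => // N' q N'0 gq qp.
pose r (k : {ffun 'I_n -> 'I_N'}) := box_length (cell_lo q k) (cell_hi q k).
pose A (j : {ffun 'I_n -> 'I_N}) := \sum_(k : {ffun 'I_n -> 'I_N'} |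
  subbox (cell_lo q k) (cell_hi q k) (cell_lo p j) (cell_hi p j)) r k.
have Age (j : {ffun 'I_n -> 'I_N}) : box_length (cell_lo p j) (cell_hi p j) <= A j.
  apply: box_length_cells => //.
  - exact: (refines_cell j qp).1.
  - exact: (refines_cell j qp).2.
  - by move=> i; exact: cell_lt.
have r0 k : 0 <= r k by exact: sqrtr_ge0.
have A0 j : 0 <= A j by exact: sumr_ge0.
pose T j := Lam * (theta * A j +
  (A j - box_length (cell_lo p j) (cell_hi p j)) / theta).
have T0 (j : {ffun 'I_n -> 'I_N}) : 0 <= T j.
  rewrite mulr_ge0 ?(ltW Lam0)// addr_ge0 ?mulr_ge0 ?(ltW theta0)//.
    by rewrite subr_ge0.
  by rewrite invr_ge0 ltW.
apply: (@le_trans _ _ (\sum_j T j)).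
  rewrite [leRHS](bigID (good_cell M p))/=.
  apply: ler_wpDr; first by apply: sumr_ge0 => j _; exact: T0.
  apply: ler_sum => j good.
  set s := mean_slope _ _; set L := Num.sqrt (1 + s ^+ 2).
  have LLam : L <= Lam.
    rewrite ler_sqrt ?addr_ge0 ?sqr_ge0// lerD2l.
    rewrite -real_normK ?num_real// -[M ^+ 2]real_normK ?num_real//.
    by rewrite ler_pXn2r// ?nnegrE// (le_trans good)// ler_norm.
  have proj : \sum_(k : {ffun 'I_n -> 'I_N'} |
      subbox (cell_lo q k) (cell_hi q k) (cell_lo p j) (cell_hi p j))
        (volume (cell_lo q k) (cell_hi q k) + s *
          joint_increment f (cell_lo q k) (cell_hi q k)) / L =
      box_length (cell_lo p j) (cell_hi p j).
    rewrite (box_length_projection gq (refines_cell j qp).1 (refines_cell j qp).2)//.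
    by move=> i; exact: cell_lt.
  apply: (@le_trans _ _ (L * (theta * A j +
      (A j - box_length (cell_lo p j) (cell_hi p j)) / theta))).
    rewrite -proj -sumrB mulr_suml mulr_sumr -big_split/= mulr_sumr.
    by apply: ler_sum => k _; exact: orthogonal_le.
  rewrite ler_wpM2r// addr_ge0 ?mulr_ge0 ?(ltW theta0)//.
    by rewrite subr_ge0.
  by rewrite invr_ge0 ltW.
rewrite -mulr_sumr big_split/= -mulr_sumr -mulr_suml sumrB.
have AJ : \sum_j A j <= grid_length N' q.
  exact: (sum_nonoverlapping_le gq (cells_nonoverlapping gp)).
have JE N2 q2 : (0 < N2)%N -> grid_partition a b N2 q2 ->
    grid_length N2 q2 <= sup E.
  by move=> N20 gq2; apply: ub_le_sup; [case: supE|exists N2, q2].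
have AB : \sum_j A j <= B.
  apply: le_trans AJ _; apply: le_trans (JE _ _ N'0 gq) _.
  by rewrite /B (le_trans (ler_norm _))// lerDl.
have Aeta : \sum_j A j - grid_length N p <= eta.
  have := grid_length_refines gp gp1 pp1; have := JE _ _ N'0 gq; lra.
apply: (@le_trans _ _ (Lam * (theta * B + eta / theta))).
  rewrite ler_wpM2l ?(ltW Lam0)// lerD//.
    by rewrite ler_wpM2l// ltW.
  by rewrite ler_wpM2r// invr_ge0 ltW.
rewrite le_eqVlt; apply/orP; left; apply/eqP; rewrite /eta thetaE.
by field; rewrite !gt_eqF.
Qed.

(** The estimate of [flat] passes to nonoverlapping boxes which are not cells of
    a grid, by refining the grid with their faces. *)
Lemma flat_family N p (M kappa : R) (K : finType) (c d : K -> 'rV[R]_n)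
    (j : K -> {ffun 'I_n -> 'I_N}) : grid_partition a b N p ->
  flat M kappa N p ->
  (forall k i, c k 0 i <= d k 0 i) ->
  (forall k, good_cell M p (j k)) ->
  (forall k, subbox (c k) (d k) (cell_lo p (j k)) (cell_hi p (j k))) ->
  (forall k l, k != l -> nonoverlapping (c k) (d k) (c l) (d l)) ->
  \sum_k `|joint_increment f (c k) (d k) -
    mean_slope (cell_lo p (j k)) (cell_hi p (j k)) * volume (c k) (d k)| <= kappa.
Proof.
move=> gp flatp cd good cdj cdN.
pose S := [seq c k | k <- enum K] ++ [seq d k | k <- enum K].
have Sab x : x \in S -> box a b x.
  move=> xS; have [k kx] : exists k, box (c k) (d k) x.
    move: xS; rewrite mem_cat => /orP[|] /mapP[k _ ->]; exists k => i.
      by rewrite lexx cd.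
    by rewrite lexx cd.
  exact: box_subbox (subbox_trans (cdj k) (cell_subbox gp (j k))) _ kx.
have [N' [q [N'0 gq qp qS]]] := refining_grid ab gp Sab.
have qc k : adapted N' q (c k).
  by apply: qS; rewrite mem_cat map_f// mem_enum.
have qd k : adapted N' q (d k).
  by apply: qS; rewrite mem_cat orbC map_f// mem_enum.
apply: le_trans (flatp _ _ N'0 gq qp).
pose Y (i : {ffun 'I_n -> 'I_N}) (k : {ffun 'I_n -> 'I_N'}) :=
  `|joint_increment f (cell_lo q k) (cell_hi q k) -
    mean_slope (cell_lo p i) (cell_hi p i) * volume (cell_lo q k) (cell_hi q k)|.
pose X (k : {ffun 'I_n -> 'I_N'}) := \sum_(i : {ffun 'I_n -> 'I_N} | good_cell M p i &&
  subbox (cell_lo q k) (cell_hi q k) (cell_lo p i) (cell_hi p i)) Y i k.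
rewrite [leRHS](_ : _ = \sum_k X k); last first.
  by rewrite (exchange_big_dep xpredT).
apply: le_trans (sum_nonoverlapping_le gq cdN _); last first.
  by move=> k; apply: sumr_ge0 => i _; exact: normr_ge0.
apply: ler_sum => k _.
rewrite (joint_increment_cells gq f (qc k) (qd k) (cd k)).
rewrite (volume_cells gq (qc k) (qd k) (cd k)) mulr_sumr -sumrB.
apply: le_trans (ler_norm_sum _ _ _) _; apply: ler_sum => l lk.
rewrite /X (bigD1 (j k))/=; last by rewrite good (subbox_trans lk).
by rewrite lerDl sumr_ge0// => i _; exact: normr_ge0.
Qed.

End variation.
(** * Lebesgue measure of boxes *)

Section boxes.
Context {R : realType}.

Lemma measurable_box n (c d : 'rV[R]_n) : measurable (box c d).
Proof.
have -> : box c d = \bigcap_(i in [set: 'I_n])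
    ((fun x : 'rV[R]_n => x 0 i : measurableTypeR R) @^-1` `[c 0 i, d 0 i]).
  by apply/seteqP; split=> x /= H i => [_|]; have := H i; rewrite /= in_itv//=; exact.
apply: fin_bigcap_measurable; first exact: finite_finset.
move=> i _; rewrite -[X in measurable X]setTI.
exact: (measurable_rV_coord i).
Qed.

Lemma rV_lebesgue_box n (c d : 'rV[R]_n) : (forall i, c 0 i <= d 0 i) ->
  rV_lebesgue n (box c d) = (volume c d)%:E.
Proof.
elim: n c d => [|n IH] c d cd.
  rewrite /= diracE mem_set ?/volume ?big_ord0//.
  by case.
pose tl (x : 'rV[R]_n.+1) : 'rV[R]_n := \row_i x 0 (lift ord0 i).
rewrite /= /rV_product /pushforward.
have -> : @rV_cons R n @^-1` box c d =
    `[c 0 ord0, d 0 ord0]%classic `*` box (tl c) (tl d).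
  apply/seteqP; split=> -[t x] /=.
    move=> H; split; first by have := H ord0; rewrite rV_cons0 /= in_itv.
    by move=> i; rewrite !mxE; have := H (lift ord0 i); rewrite rV_consS.
  rewrite in_itv/= => -[tcd xcd] i.
  case: (unliftP ord0 i) => [k|] ->; last by rewrite rV_cons0.
  by rewrite rV_consS; have := xcd k; rewrite !mxE.
rewrite product_measure1E//; last exact: measurable_box.
rewrite IH; last by move=> i; rewrite !mxE.
rewrite /volume big_ord_recl EFinM; congr (_ * _)%E; last first.
  by congr (_%:E); apply: eq_bigr => i _; rewrite !mxE.
apply: etrans (lebesgue_measure_itv _) _.
by rewrite /= lte_fin; case: ltgtP (cd ord0) => // -> _; rewrite subrr.
Qed.

Lemma measurable_lebesgue_rV n (A : set 'rV[R]_n) :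
  measurable A -> measurable (A : set (lebesgue_rV R n)).
Proof. by move=> mA; apply: sub_caratheodory; exact: sub_sigma_algebra. Qed.

Lemma measurable_lebesgue_box n (c d : 'rV[R]_n) :
  measurable (box c d : set (lebesgue_rV R n)).
Proof. exact: (measurable_lebesgue_rV (measurable_box c d)). Qed.

Lemma lebesgue_box n (c d : 'rV[R]_n) : (forall i, c 0 i <= d 0 i) ->
  lebesgue_measure_rV n (box c d) = (volume c d)%:E.
Proof.
move=> cd; rewrite -rV_lebesgue_box//.
exact: (measurable_mu_extE _ (measurable_box c d)).
Qed.

Lemma interior_open_box n (c d x : 'rV[R]_n) :
  (forall i, c 0 i < x 0 i < d 0 i) -> (box c d)° x.
Proof.
move=> xcd.
pose e := \big[Order.min/1]_i Order.min (x 0 i - c 0 i) (d 0 i - x 0 i).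
have e0 : 0 < e.
  rewrite /e; elim/big_ind : _ => // [u v u0 v0|i _]; first by rewrite lt_min u0.
  by rewrite lt_min !subr_gt0.
have ei i : e <= x 0 i - c 0 i /\ e <= d 0 i - x 0 i.
  have : e <= Order.min (x 0 i - c 0 i) (d 0 i - x 0 i) by exact: bigmin_le_cond.
  by rewrite le_min => /andP.
apply/nbhs_ballP; exists e => //= y [_ xy] i.
have := xy 0 i; rewrite /ball/= ltr_norml => /andP[h1 h2].
by have [h3 h4] := ei i; apply/andP; split; lra.
Qed.

Lemma interior_box n (c d x : 'rV[R]_n) : (box c d)° x ->
  forall i, c 0 i < x 0 i < d 0 i.
Proof.
move=> /nbhs_ballP[e /= e0 xe] i.
have step s : `|s| < e -> box c d (x + const_mx s).
  move=> se; apply: xe; split => // j k; rewrite /ball/= !mxE.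
  by rewrite opprD addNKr normrN.
have e20 : 0 < e / 2 by rewrite divr_gt0.
have e2 : e / 2 < e by rewrite ltr_pdivrMr// ltr_pMr// ltr1n.
have := step (e / 2); rewrite gtr0_norm// => /(_ e2 i); rewrite !mxE.
have := step (- (e / 2)); rewrite normrN gtr0_norm// => /(_ e2 i); rewrite !mxE.
by move=> /andP[h1 h2] /andP[h3 h4]; apply/andP; split; lra.
Qed.

Lemma nonoverlapping_interior n (c d c' d' : 'rV[R]_n) :
  (box c d)° `&` (box c' d')° = set0 -> nonoverlapping c d c' d'.
Proof.
move=> disj u v uv uvc uvc'.
have mid i : u 0 i < ((1 / 2 : R) *: (u + v)) 0 i < v 0 i.
  by rewrite !mxE; have := uv i => h; apply/andP; split; lra.
have := interior_open_box mid => m.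
suff : ((box c d)° `&` (box c' d')°) ((1 / 2 : R) *: (u + v)) by rewrite disj.
by split; [exact: (interiorS (box_subbox uvc))|exact: (interiorS (box_subbox uvc'))].
Qed.

Lemma interior_nonoverlapping n (c d c' d' : 'rV[R]_n) :
  nonoverlapping c d c' d' -> (box c d)° `&` (box c' d')° = set0.
Proof.
move=> no; apply/seteqP; split => // x [/interior_box xc /interior_box xc'].
pose u : 'rV[R]_n := \row_i Order.max (c 0 i) (c' 0 i).
pose v : 'rV[R]_n := \row_i Order.min (d 0 i) (d' 0 i).
apply: (no u v) => [i||].
- rewrite !mxE (@lt_trans _ _ (x 0 i))//.
    by rewrite gt_max (andP (xc i)).1 (andP (xc' i)).1.
  by rewrite lt_min (andP (xc i)).2 (andP (xc' i)).2.
- by apply/subboxP => i; rewrite !mxE le_max lexx ge_min lexx.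
- by apply/subboxP => i; rewrite !mxE le_max lexx orbT ge_min lexx orbT.
Qed.

End boxes.

(** * A covering lemma for cubes *)

Section vitali.
Context {R : realType} {n : nat}.
Implicit Types (u v : 'rV[R]_n * R) (s t : seq ('rV[R]_n * R)).

(** A pair [u] stands for the cube of side [u.2] with lowest corner [u.1]. *)
Definition cubes_meet u v : bool :=
  [forall i, (u.1 0 i <= v.1 0 i + v.2) && (v.1 0 i <= u.1 0 i + u.2)].

Definition packing (C : set ('rV[R]_n * R)) s : Prop :=
  (forall u, u \in s -> C u) /\ pairwise (fun u v => ~~ cubes_meet u v) s.

Variables (C : set ('rV[R]_n * R)) (K : R).
Hypothesis C01 : forall u, C u -> 0 < u.2 <= 1.
Hypothesis CK : forall s, packing C s -> \sum_(u <- s) u.2 ^+ n <= K.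

(** A maximal extension exists because the number of cubes with sides larger than
    [r] in a packing is at most [K / r ^+ n]. *)
Lemma packing_extend s (r : R) : 0 < r -> packing C s ->
  exists t, [/\ packing C (t ++ s), forall u, u \in t -> r < u.2 &
    forall u, C u -> r < u.2 -> exists2 v, v \in t ++ s & cubes_meet u v].
Proof.
move=> r0 ps; apply: contrapT => no.
have grow m : exists t,
    [/\ packing C (t ++ s), forall u, u \in t -> r < u.2 & size t = m].
  elim: m => [|m [t [pts tr szt]]]; first by exists [::].
  have [u [Cu ur um]] : exists u, [/\ C u, r < u.2 &
      forall v, v \in t ++ s -> ~~ cubes_meet u v].
    apply: contrapT => no'; apply: no; exists t; split => // u Cu ru.
    apply: contrapT => no2; apply: no'; exists u; split => // v vts.
    by apply/negP => uv; apply: no2; exists v.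
  exists (u :: t); split => /=; last by rewrite szt.
  - split; last by rewrite /= pts.2 andbT; apply/allP.
    by move=> v; rewrite inE => /predU1P[->//|/pts.1].
  - by move=> v; rewrite inE => /predU1P[->//|/tr].
have rn0 : 0 < r ^+ n by rewrite exprn_gt0.
have [t [pts tr szt]] := grow (Num.bound (K / r ^+ n)).
have := CK pts; rewrite leNgt => /negP; apply.
rewrite big_cat/= ltr_wpDr//.
  rewrite big_seq; apply: sumr_ge0 => u us.
  by rewrite exprn_ge0// ltW//; have /andP[] := C01 (ps.1 _ us).
apply: (@lt_le_trans _ _ (\sum_(u <- t) r ^+ n)); last first.
  rewrite big_seq [leRHS]big_seq; apply: ler_sum => u /tr ru.
  by apply: lerXn2r; rewrite ?nnegrE ?ltW// (lt_trans r0).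
rewrite big_const_seq count_predT iter_addr addr0 -mulr_natr szt mulrC -ltr_pdivrMr//.
have K0 : 0 <= K by have := @CK [::]; rewrite big_nil; apply; split.
by rewrite archi_boundP// divr_ge0// ltW.
Qed.

Lemma measure_bigsetU_le d (T : measurableType d) (mu : {measure set T -> \bar R})
    (I : Type) (r : seq I) (A : I -> set T) : (forall i, measurable (A i)) ->
  (mu (\big[setU/set0]_(i <- r) A i) <= \sum_(i <- r) mu (A i))%E.
Proof.
move=> mA; elim: r => [|i r IH]; first by rewrite !big_nil measure0.
rewrite !big_cons; apply: le_trans (measureU2 _ _ _) _ => //.
  by apply: bigsetU_measurable => j _.
by rewrite leeD2l.
Qed.

(** Vitali's covering argument: the cubes are packed greedily, those with sides
    between [2 ^- k.+1] and [2 ^- k] at step [k].  A cube of [C] then meets a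
    packed one of at least half its side, say of corner [y] and side [g]; so its
    corner lies in the box from [y - 2 g] to [y + g], of volume [(3 g) ^+ n]. *)
Lemma packing_cover : exists2 G : set (lebesgue_rV R n),
  measurable G /\ (lebesgue_measure_rV n G <= (3 ^+ n * K)%:E)%E &
  forall u, C u -> G u.1.
Proof.
pose r k : R := 2 ^- k.+1.
have r0 k : 0 < r k by rewrite invr_gt0 exprn_gt0.
have /choice[ext extP] : forall sr : seq ('rV[R]_n * R) * R, exists t,
    0 < sr.2 -> packing C sr.1 -> [/\ packing C (t ++ sr.1),
      forall u, u \in t -> sr.2 < u.2 &
      forall u, C u -> sr.2 < u.2 -> exists2 v, v \in t ++ sr.1 & cubes_meet u v].
  move=> [s rho]; have [rho0|] := pselect (0 < rho); last by exists [::].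
  have [ps|] := pselect (packing C s); last by exists [::].
  by have [t tP] := packing_extend rho0 ps; exists t.
pose F := fix F k := if k is k'.+1 then ext (F k', r k') ++ F k' else [::].
have pF k : packing C (F k).
  by elim: k => [|k IH] //=; have [] := extP (F k, r k) (r0 k) IH.
have Fr k u : u \in F k.+1 -> r k < u.2.
  elim: k u => [|k IH] u; rewrite [F _]/= mem_cat => /orP[uext|uF].
  - by have [_ H _] := extP ([::], r 0%N) (r0 _) (pF 0%N); exact: H.
  - by [].
  - by have [_ H _] := extP (F k.+1, r k.+1) (r0 _) (pF k.+1); exact: H.
  - apply: lt_trans (IH _ uF); rewrite ltf_pV2 ?posrE ?exprn_gt0//.
    by rewrite ltr_eXn2l// ltr1n.
have Fmax k u : C u -> r k < u.2 -> exists2 v, v \in F k.+1 & cubes_meet u v.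
  by have [_ _ H] := extP (F k, r k) (r0 k) (pF k); exact: H.
pose B v : set (lebesgue_rV R n) :=
  box (v.1 - const_mx (v.2 *+ 2)) (v.1 + const_mx v.2).
pose U k := \big[setU/set0]_(v <- F k) B v.
have mU k : measurable (U k).
  by apply: bigsetU_measurable => v _; exact: measurable_lebesgue_box.
have mUU : measurable (\bigcup_k U k) by exact: bigcup_measurable.
exists (\bigcup_k U k); first split => //.
- have ndU : {homo U : k l / (k <= l)%N >-> (k <= l)%O}.
    apply: homo_leq => [A|A1 A2 A3|k]; [exact: lexx|exact: le_trans|].
    by apply/subsetPset => x; rewrite /U /= big_cat/=; right.
  have cvgU :=
    @nondecreasing_cvg_mu _ _ _ (lebesgue_measure_rV n) _ mU mUU ndU.
  rewrite -(cvg_lim _ cvgU)//; apply: lime_le.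
    by apply/cvg_ex; eexists; exact: cvgU.
  apply: nearW => k /=; apply: le_trans (measure_bigsetU_le _ _ _) _.
    by move=> v; exact: measurable_lebesgue_box.
  apply: (@le_trans _ _ (3 ^+ n * \sum_(v <- F k) v.2 ^+ n)%:E); last first.
    by rewrite lee_fin ler_wpM2l ?exprn_ge0//; exact: CK.
  rewrite mulr_sumr -sumEFin big_seq [leRHS]big_seq; apply: lee_sum => v vF.
  have v0 : 0 < v.2 by have /andP[] := C01 ((pF k).1 _ vF).
  rewrite /B lebesgue_box => [|i]; last by rewrite !mxE; lra.
  rewrite lee_fin /volume le_eqVlt; apply/orP; left; apply/eqP.
  rewrite (eq_bigr (fun=> 3 * v.2)) => [|i _]; last by rewrite !mxE; ring.
  by rewrite prodr_const card_ord exprMn.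
- move=> u Cu; have /andP[u0 u1] := C01 Cu.
  have [k ku] : exists k, r k < u.2 <= 2 * r k.
    have ex : exists k, r k < u.2.
      have [k ku] : exists k, (Num.bound u.2^-1 <= k)%N by exists (Num.bound u.2^-1).
      exists k; rewrite invf_plt ?posrE ?exprn_gt0//.
      apply: lt_le_trans (archi_boundP _) _; first by rewrite invr_ge0 ltW.
      rewrite -natrX ler_nat; apply: leq_trans ku _.
      by apply: leq_trans (leqnSn _) _; exact/ltnW/ltn_expl.
    case: (ex_minnP ex) => k ku kmin; exists k; rewrite ku/=.
    case: k ku kmin => [_ _|k ku kmin].
      by rewrite /r expr1 mulfV ?pnatr_eq0.
    have -> : 2 * r k.+1 = r k by rewrite /r exprS invfM mulrA mulfV ?mul1r ?pnatr_eq0.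
    by rewrite leNgt; apply/negP => /kmin; rewrite ltnn.
  have /andP[ku1 ku2] := ku.
  have [v vF uv] := Fmax k u Cu ku1.
  exists k.+1 => //; rewrite /U -bigcup_seq; exists v => // i.
  have /andP[h1 h2] := forallP uv i; rewrite !mxE.
  by have := Fr _ _ vF => h3; apply/andP; split; lra.
Qed.

End vitali.
(** * Integrals of step functions *)

Section step_integrals.
Local Open Scope ereal_scope.
Context d (T : measurableType d) (R : realType).
Variable mu : {measure set T -> \bar R}.
Import HBNNSimple.

(** The integral of a nonnegative function is a supremum over the simple functions
    below it, hence is monotone for arbitrary functions, such as the modulus of
    the joint derivative. *)
Lemma integral_mono (g k : T -> \bar R) : (forall x, 0 <= g x) ->
  (forall x, g x <= k x) -> \int[mu]_x g x <= \int[mu]_x k x.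
Proof.
move=> g0 gk; rewrite !ge0_integralTE//; last by move=> x; exact: le_trans (gk x).
apply: ge_ereal_sup => _ [h /= hg <-]; apply: ereal_sup_ge.
by exists (sintegral mu h) => //; exists h => // x; exact: le_trans (gk x).
Qed.

(** Subadditivity with an arbitrary [h]: the positive part of
    [phi - psi] is measurable and below [h]. *)
Lemma integral_sub_le (phi psi : T -> R) (h : T -> \bar R) :
  measurable_fun setT phi -> measurable_fun setT psi ->
  (forall x, 0 <= phi x)%R -> (forall x, 0 <= psi x)%R -> (forall x, 0 <= h x) ->
  (forall x, (phi x)%:E <= h x + (psi x)%:E) ->
  \int[mu]_x (phi x)%:E <= \int[mu]_x h x + \int[mu]_x (psi x)%:E.
Proof.
move=> mphi mpsi phi0 psi0 h0 le.
pose w x := Num.max (phi x - psi x)%R 0%R.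
have mw : measurable_fun setT w.
  by apply: measurable_maxr => //; exact: measurable_funB.
have w0 x : (0 <= w x)%R by rewrite /w le_max lexx orbT.
apply: (@le_trans _ _ (\int[mu]_x ((w x)%:E + (psi x)%:E))).
  apply: integral_mono => x; first by rewrite lee_fin.
  by rewrite -EFinD lee_fin /w -lerBlDr le_max lexx.
rewrite ge0_integralD//=.
- apply: leeD => //; apply: integral_mono => x; first by rewrite lee_fin.
  rewrite /w; case: (leP (phi x - psi x)%R 0%R) => // _.
  by rewrite EFinB leeBlDr.
- by move=> x _; rewrite lee_fin.
- exact/measurable_EFinP.
- by move=> x _; rewrite lee_fin.
- exact/measurable_EFinP.
Qed.

Definition steps (s : seq (R * set T)) (x : T) : R :=
  (\sum_(u <- s) u.1 * \1_(u.2) x)%R.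

Definition nonneg_steps (s : seq (R * set T)) : Prop :=
  forall k, (k < size s)%N ->
    (0 <= (nth (0%R, set0) s k).1)%R /\ measurable (nth (0%R, set0) s k).2.

Lemma nonneg_steps_cons u s : (0 <= u.1)%R -> measurable u.2 ->
  nonneg_steps s -> nonneg_steps (u :: s).
Proof. by move=> u0 mu2 ss [|k] //= ks; exact: ss. Qed.

Lemma nonneg_steps_cat s t :
  nonneg_steps s -> nonneg_steps t -> nonneg_steps (s ++ t).
Proof.
move=> ss tt k; rewrite size_cat nth_cat; case: (ltnP k (size s)) => [ks _|sk kst].
  exact: ss.
by apply: tt; rewrite ltn_subLR.
Qed.

Lemma nonneg_steps_map (I : Type) (s : seq I) (w : I -> R) (A : I -> set T) :
  (forall i, 0 <= w i)%R -> (forall i, measurable (A i)) ->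
  nonneg_steps [seq (w i, A i) | i <- s].
Proof.
move=> w0 mA; elim: s => [|i s IH]; first by case.
by have := @nonneg_steps_cons (w i, A i) _ (w0 i) (mA i) IH; exact.
Qed.

Lemma nonneg_steps_tail u s : nonneg_steps (u :: s) ->
  [/\ (0 <= u.1)%R, measurable u.2 & nonneg_steps s].
Proof.
move=> ss; have [u0 mu2] := ss 0%N isT; split => // k ks.
exact: (ss k.+1 ks).
Qed.

Lemma steps_ge0 s x : nonneg_steps s -> (0 <= steps s x)%R.
Proof.
rewrite /steps; elim: s => [|u s IH]; first by rewrite big_nil.
move=> /nonneg_steps_tail[u0 _ /IH s0]; rewrite big_cons addr_ge0//.
by rewrite mulr_ge0.
Qed.

Lemma steps_cat s t x : steps (s ++ t) x = (steps s x + steps t x)%R.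
Proof. by rewrite /steps big_cat. Qed.

Lemma steps_cons u s x : steps (u :: s) x = (u.1 * \1_(u.2) x + steps s x)%R.
Proof. by rewrite /steps big_cons. Qed.

Lemma steps_map (I : Type) (s : seq I) (w : I -> R) (A : I -> set T) x :
  steps [seq (w i, A i) | i <- s] x = (\sum_(i <- s) w i * \1_(A i) x)%R.
Proof. by rewrite /steps big_map. Qed.

Lemma measurable_steps s : nonneg_steps s -> measurable_fun setT (steps s).
Proof.
elim: s => [|u s IH].
  by move=> _; apply: eq_measurable_fun (@measurable_cst _ _ _ _ _ (0%R : R)) => x _;
    rewrite /steps big_nil.
move=> /nonneg_steps_tail[_ mu2 /IH ms].
apply: (eq_measurable_fun (fun x => u.1 * \1_(u.2) x + steps s x)%R) => [x _|].
  by rewrite steps_cons.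
by apply: measurable_funD => //; apply: measurable_funM.
Qed.

Lemma integral_steps s : nonneg_steps s ->
  \int[mu]_x (steps s x)%:E = \sum_(u <- s) u.1%:E * mu u.2.
Proof.
elim: s => [_|u s IH].
  by rewrite big_nil integral0_eq// => x _; rewrite /steps big_nil.
move=> /nonneg_steps_tail[u0 mu2 ss]; rewrite big_cons -IH//.
under eq_integral => x _ do rewrite steps_cons EFinD.
rewrite ge0_integralD//.
- congr (_ + _); under eq_integral => x _ do rewrite EFinM.
  rewrite ge0_integralZl//=.
    by rewrite integral_indic// setIT.
  by apply/measurable_EFinP; apply: measurable_indic.
- by move=> x _; rewrite lee_fin mulr_ge0.
- by apply/measurable_EFinP; exact: measurable_funM.
- by move=> x _; rewrite lee_fin steps_ge0.
- by apply/measurable_EFinP; exact: measurable_steps.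
Qed.

End step_integrals.
(** * Almost everywhere existence and approximation of the derivative *)

Section derivative.
Context {R : realType} {n : nat}.
Implicit Types (N : nat) (p : 'I_n -> nat -> R).
Variables (a b : 'rV[R]_n) (f : 'rV[R]_n -> R) (V : R).
Hypothesis ab : forall i, a 0 i < b 0 i.
Hypothesis fV : forall N p, (0 < N)%N -> grid_partition a b N p ->
  grid_variation f N p <= V.

Local Notation mu := (lebesgue_measure_rV n).
Local Notation slope p j := (mean_slope f (cell_lo p j) (cell_hi p j)).

Definition open_cell p N (j : {ffun 'I_n -> 'I_N}) : set 'rV[R]_n :=
  [set x | forall i, p i (j i) < x 0 i < p i (j i).+1].

Lemma volume_cube (x : 'rV[R]_n) (h : R) :
  volume x (\row_i (x 0 i + h)) = h ^+ n.
Proof.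
rewrite /volume (eq_bigr (fun=> h)) ?prodr_const ?card_ord// => i _.
by rewrite mxE addrC addKr.
Qed.

(** Maximal inequality.  A cube in a good cell is steep when its increment
    deviates from the mean slope of the cell by more than [eps] times its volume.
    On a flat grid a packing of steep cubes has a total volume of at most
    [kappa / eps], so by [packing_cover] the corners of the steep cubes form a
    small set; elsewhere the quotients are eventually within [eps] of the mean
    slope. *)
Lemma flat_derivative (S : seq 'rV[R]_n) (M eps : R) : 0 < eps ->
  (forall x, x \in S -> box a b x) ->
  exists N p, [/\ (0 < N)%N, grid_partition a b N p,
    forall x, x \in S -> adapted N p x &
    exists2 G : set (lebesgue_rV R n),
      measurable G /\ (mu G <= eps%:E)%E &
      forall (j : {ffun 'I_n -> 'I_N}) x, good_cell f M p j -> open_cell p j x ->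
        ~ G x -> exists2 h0, 0 < h0 &
          forall h, 0 < h -> h < h0 -> `|joint_quotient f x h - slope p j| <= eps].
Proof.
move=> eps0 Sab.
(* The enlargement in [packing_cover] costs [3 ^+ n] and the steepness [eps]. *)
pose kappa := eps * (eps / 3 ^+ n).
have kappa0 : 0 < kappa by rewrite mulr_gt0// divr_gt0// exprn_gt0.
have [N [p [N0 gp pS flatp]]] := flat_grid ab fV M kappa0 Sab.
pose top (u : 'rV[R]_n * R) : 'rV[R]_n := \row_i (u.1 0 i + u.2).
pose steep (u : 'rV[R]_n * R) (j : {ffun 'I_n -> 'I_N}) :=
  [/\ good_cell f M p j, subbox u.1 (top u) (cell_lo p j) (cell_hi p j) &
      eps * u.2 ^+ n < `|joint_increment f u.1 (top u) - slope p j * u.2 ^+ n|].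
pose C := [set u : 'rV[R]_n * R | 0 < u.2 <= 1 /\ exists j, steep u j].
have C01 u : C u -> 0 < u.2 <= 1 by case.
have CK s : packing C s -> \sum_(u <- s) u.2 ^+ n <= eps / 3 ^+ n.
  move=> [sC sP].
  pose c (k : 'I_(size s)) := nth (0, 0) s k.
  have cC k : C (c k) by apply: sC; rewrite mem_nth.
  have /choice[j jP] : forall k, exists j, steep (c k) j by move=> k; have [] := cC k.
  have fam := @flat_family _ _ a b f ab N p M kappa _ (fun k => (c k).1)
    (fun k => top (c k)) j gp flatp.
  rewrite -(ler_pM2l eps0) mulr_sumr (big_nth (0, 0)) big_mkord.
  apply: (le_trans _ (fam _ _ _ _)).
  - apply: ler_sum => k _; have [_ _ /ltW] := jP k.
    by rewrite /top volume_cube.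
  - by move=> k i; rewrite mxE lerDl ltW//; have [/andP[]] := cC k.
  - by move=> k; have [] := jP k.
  - by move=> k; have [] := jP k.
  - have meet k l (u v : 'rV[R]_n) : (forall i, u 0 i < v 0 i) ->
        subbox u v (c k).1 (top (c k)) -> subbox u v (c l).1 (top (c l)) ->
        cubes_meet (c k) (c l).
      move=> uv /subboxP uk /subboxP ul; apply/forallP => i.
      have [+ +] := uk i; have [+ +] := ul i; have := uv i; rewrite !mxE.
      by move=> h1 h2 h3 h4 h5; apply/andP; split; lra.
    have /(pairwiseP (0, 0)) sP' := sP.
    move=> k l kl u v uv uk ul.
    have [lt|ge] := ltnP k l.
      by have /negP := sP' k l (ltn_ord k) (ltn_ord l) lt; apply; exact: meet ul.
    have lt : (l < k)%N by rewrite ltn_neqAle ge andbT eq_sym.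
    by have /negP := sP' l k (ltn_ord l) (ltn_ord k) lt; apply; exact: meet uk.
have [G [mG muG] CG] := packing_cover C01 CK.
exists N, p; split => //; exists G; first split => //.
  by rewrite mulrCA mulfV ?mulr1 ?gt_eqF ?exprn_gt0// in muG.
move=> j x good jx Gx.
pose h0 := \big[Order.min/1]_i (p i (j i).+1 - x 0 i).
have h00 : 0 < h0.
  rewrite /h0; elim/big_ind : _ => // [u v u0 v0|i _]; first by rewrite lt_min u0.
  by rewrite subr_gt0; have /andP[] := jx i.
exists h0 => // h hgt0 hh0.
have h1 : h <= 1.
  by apply/ltW/(lt_le_trans hh0); rewrite /h0; exact: bigmin_le_id.
have hi i : h <= p i (j i).+1 - x 0 i.
  by apply/ltW/(lt_le_trans hh0); exact: bigmin_le_cond.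
rewrite leNgt; apply/negP => steep_h; apply: Gx; apply: (CG (x, h)).
split; first by rewrite /= hgt0.
exists j; split => //=.
  apply/subboxP => i; rewrite cell_loE cell_hiE mxE/= -lerBrDl hi.
  by split => //; apply/ltW; have /andP[] := jx i.
have hn0 : 0 < h ^+ n by rewrite exprn_gt0.
rewrite -ltr_pdivlMr// -[X in _ < _ / X](gtr0_norm hn0) -normf_div mulrBl mulfK//.
by rewrite gt_eqF.
Qed.

(** A point outside of the open cells lies on a face, and a face is a box with an
    edge of length zero. *)
Lemma grid_faces N p : (0 < N)%N -> grid_partition a b N p ->
  exists Z : set (lebesgue_rV R n), [/\ measurable Z, mu Z = 0%E &
    forall x, box a b x -> ~ Z x ->
      exists j : {ffun 'I_n -> 'I_N}, open_cell p j x].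
Proof.
move=> N0 gp.
pose face (u : 'I_n * 'I_N.+1) : set (lebesgue_rV R n) :=
  box (\row_l if l == u.1 then p u.1 u.2 else a 0 l)
      (\row_l if l == u.1 then p u.1 u.2 else b 0 l).
have mface u : measurable (face u) by exact: measurable_lebesgue_box.
exists (\big[setU/set0]_u face u); split.
- by apply: bigsetU_measurable => u _.
- apply/eqP; rewrite eq_le measure_ge0 andbT.
  apply: le_trans (measure_bigsetU_le _ _ mface) _.
  rewrite big1// => u _; rewrite /face lebesgue_box => [|i].
    by rewrite /volume (bigD1 u.1)//= !mxE eqxx subrr mul0r.
  by rewrite !mxE; case: ifP => // _; exact: ltW.
- move=> x xab xZ.
  have neq i k : (k <= N)%N -> x 0 i != p i k.
    move=> kN; apply/eqP => xik; apply: xZ.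
    rewrite -bigcup_seq; exists (i, inord k); first by rewrite /= mem_index_enum.
    move=> l; rewrite !mxE inordK//.
    by case: eqP => [->|_]; rewrite ?xik ?lexx//; exact: xab.
  have xab' i : a 0 i <= x 0 i < b 0 i.
    have /andP[-> xb] := xab i; rewrite lt_neqAle xb andbT.
    by have [_ <- _] := gp i; exact: neq.
  have [j jP] := box_cell gp N0 xab'.
  exists j => i; have /andP[lo ->] := jP i; rewrite andbT lt_neqAle lo andbT.
  by rewrite eq_sym neq// ltnW.
Qed.

(** Chebyshev's inequality for the mean slopes. *)
Lemma bad_cells_volume N p (M : R) : 0 < M -> (0 < N)%N -> grid_partition a b N p ->
  \sum_(j : {ffun 'I_n -> 'I_N} | ~~ good_cell f M p j)
    volume (cell_lo p j) (cell_hi p j) <= V / M.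
Proof.
move=> M0 N0 gp; rewrite ler_pdivlMr// mulr_suml.
apply: le_trans (fV N0 gp).
rewrite /grid_variation [leRHS](bigID (fun j => ~~ good_cell f M p j))/=.
apply: ler_wpDr; first by apply: sumr_ge0.
apply: ler_sum => j; rewrite /good_cell -ltNge => bad.
have v0 := volume_gt0 (cell_lt gp j).
rewrite -/(cell_lo p j) -/(cell_hi p j) mulrC -ler_pdivlMr// ltW//.
by rewrite -[X in _ / X](gtr0_norm v0) -normf_div.
Qed.

Lemma open_cell_interior N p (j : {ffun 'I_n -> 'I_N}) : grid_partition a b N p ->
  open_cell p j `<=` (box a b)°.
Proof.
move=> gp x jx; apply: (interiorS (box_subbox (cell_subbox gp j))).
by apply: interior_open_box => i; rewrite cell_loE cell_hiE; exact: jx.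
Qed.

(** The quotients at [x] oscillate by at most [2 * eps]; the interiority is the
    other half of [joint_derivable]. *)
Definition nearly_derivable (eps : R) (x : 'rV[R]_n) : Prop :=
  (box a b)° x /\ exists s, exists2 h0, 0 < h0 &
    forall h, 0 < h -> h < h0 -> `|joint_quotient f x h - s| <= eps.

Lemma nearly_derivable_cvg x : (forall k, nearly_derivable k.+1%:R^-1 x) ->
  joint_derivable a b f x.
Proof.
move=> near; split; first by have [] := near 0%N.
apply/cauchy_cvgP/cauchy_exP => eps eps0 /=.
have [k keps] : exists k, k.+1%:R^-1 < eps.
  exists (Num.bound eps^-1); rewrite invf_plt ?posrE//.
  apply: lt_le_trans (archi_boundP _) _; first by rewrite invr_ge0 ltW.
  by rewrite ler_nat.
have [_ [s [h0 h00 hs]]] := near k; exists s.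
near=> h; rewrite /ball/= distrC; apply: le_lt_trans keps.
by apply: hs; near: h; [exact: nbhs_right_gt|exact: nbhs_right_lt].
Unshelve. all: by end_near. Qed.

(** The exceptional points lie in the bad cells, on the faces or in the small set
    of [flat_derivative]; a large [M] and a fine precision make them as few as
    wanted, whatever [eps]. *)
Lemma small_exception (eps tau : R) : 0 < eps -> 0 < tau ->
  exists E : set (lebesgue_rV R n), [/\ measurable E, (mu E <= tau%:E)%E &
    forall x, box a b x -> ~ E x -> nearly_derivable eps x].
Proof.
move=> eps0 tau0.
have V0 := variation_bound_ge0 ab fV.
pose M := 2 * (V + 1) / tau.
have M0 : 0 < M by rewrite divr_gt0// mulr_gt0// ltr_wpDl.
pose e := Num.min eps (tau / 2).
have e0 : 0 < e by rewrite lt_min eps0 divr_gt0.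
have [//|N [p [N0 gp _ [G [mG muG] GP]]]] := @flat_derivative [::] M e e0.
have [Z [mZ muZ ZP]] := grid_faces N0 gp.
pose bad := [seq j <- index_enum {ffun 'I_n -> 'I_N} | ~~ good_cell f M p j].
pose cell j : set (lebesgue_rV R n) := box (cell_lo p j) (@cell_hi _ _ p N j).
pose U := \big[setU/set0]_(j <- bad) cell j.
have mbox j : measurable (cell j) by exact: measurable_lebesgue_box.
have mU : measurable U by apply: bigsetU_measurable => j _; exact: mbox.
have muU : (mu U <= (tau / 2)%:E)%E.
  apply: le_trans (measure_bigsetU_le mu bad mbox) _.
  rewrite big_filter (eq_bigr (fun j => (volume (cell_lo p j) (cell_hi p j))%:E)).
    rewrite sumEFin lee_fin; apply: le_trans (bad_cells_volume M0 N0 gp) _.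
    rewrite /M invf_div mulrA ler_pdivrMr ?mulr_gt0 ?ltr_wpDl//.
    by have := tau0; nra.
  by move=> j _; apply: lebesgue_box => i; exact/ltW/(cell_lt gp).
exists (G `|` Z `|` U); split.
- by apply: measurableU => //; exact: measurableU.
- apply: (@le_trans _ _ (mu G + mu Z + mu U)%E).
    apply: le_trans (measureU2 _ _ _) _ => //; first exact: measurableU.
    by rewrite leeD2r//; exact: measureU2.
  rewrite muZ adde0 [leRHS](_ : _ = ((tau / 2)%:E + (tau / 2)%:E)%E); last first.
    by rewrite -EFinD; congr EFin; lra.
  apply: leeD => //; apply: le_trans muG _.
  by rewrite lee_fin /e ge_min lexx orbT.
- move=> x xab xE.
  have [j jx] : exists j : {ffun 'I_n -> 'I_N}, open_cell p j x.
    by apply: ZP => // Zx; apply: xE; left; right.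
  have good : good_cell f M p j.
    apply/negPn/negP => bj; apply: xE; right; rewrite /U -bigcup_seq.
    exists j; first by rewrite /= mem_filter bj mem_index_enum.
    by move=> i; rewrite cell_loE cell_hiE; have /andP[/ltW -> /ltW ->] := jx i.
  split; first exact: (open_cell_interior gp jx).
  exists (slope p j).
  have [|h0 h00 h0P] := GP j x good jx; first by move=> Gx; apply: xE; left; left.
  exists h0 => // h hgt0 hh0; apply: le_trans (h0P _ hgt0 hh0) _.
  by rewrite /e ge_min lexx.
Qed.

(** Lebesgue's differentiation theorem for functions of bounded variation: by
    [small_exception] the failure of the Cauchy criterion at each precision is
    a null set. *)
Lemma ae_joint_derivable : exists Z : set (lebesgue_rV R n),
  [/\ measurable Z, mu Z = 0%E &
    forall x, box a b x -> ~ Z x -> joint_derivable a b f x].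
Proof.
have /choice[E EP] : forall km : nat * nat, exists E : set (lebesgue_rV R n),
    [/\ measurable E, (mu E <= (km.2.+1%:R^-1)%:E)%E &
    forall x, box a b x -> ~ E x -> nearly_derivable km.1.+1%:R^-1 x].
  by move=> km; apply: small_exception; rewrite invr_gt0.
have mE km : measurable (E km) by have [] := EP km.
have mI k : measurable (\bigcap_m E (k, m)) by exact: bigcap_measurable.
have I0 k : mu (\bigcap_m E (k, m)) = 0%E.
  apply/eqP; rewrite eq_le measure_ge0 andbT; apply/lee_addgt0Pr => e e0.
  rewrite add0e.
  have [m me] : exists m, m.+1%:R^-1 <= e.
    exists (Num.bound e^-1); rewrite invf_ple ?posrE//.
    apply/ltW/(lt_le_trans (archi_boundP _)); first by rewrite invr_ge0 ltW.
    by rewrite ler_nat.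
  have [_ le _] := EP (k, m).
  apply: (@le_trans _ _ (mu (E (k, m)))).
    2: by apply: le_trans le _; rewrite lee_fin.
  by apply: le_measure; rewrite ?inE//; exact: bigcap_inf.
have [Z [mZ muZ ZP]] : mu.-negligible (\bigcup_k \bigcap_m E (k, m)).
  apply: negligible_bigcup => k; exists (\bigcap_m E (k, m)).
  by split; [exact: mI|exact: I0|exact: subset_refl].
exists Z; split => // x xab Zx; apply: nearly_derivable_cvg => k.
have [m xm] : exists m, ~ E (k, m) x.
  by apply/existsNP => H; apply: Zx; apply: ZP; exists k => // m _; exact: H.
by have [_ _] := EP (k, m); apply.
Qed.

Lemma joint_derivative_near (x : 'rV[R]_n) (s eps h0 : R) :
  joint_derivable a b f x -> 0 < h0 ->
  (forall h, 0 < h -> h < h0 -> `|joint_quotient f x h - s| <= eps) ->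
  `|joint_derivative a b f x - s| <= eps.
Proof.
move=> der h00 hs; rewrite /joint_derivative asboolT//.
set l := lim _; have cvgl : joint_quotient f x h @[h --> 0^'+] --> l := der.2.
rewrite leNgt; apply/negP => ls.
have e0 : 0 < `|l - s| - eps by rewrite subr_gt0.
have nearh : \forall h \near 0^'+,
    (`|l - joint_quotient f x h| < `|l - s| - eps /\ 0 < h) /\ h < h0.
  near=> h; split; [split|]; near: h.
  - exact: (@cvgr_dist_lt _ _ _ _ _ _ _ cvgl).
  - exact: nbhs_right_gt.
  - exact: nbhs_right_lt.
have [h [[q1 hgt0] hh0]] :=
  @filter_ex _ _ (at_right_proper_filter (0 : R)) _ nearh.
have := ler_distD (joint_quotient f x h) l s; rewrite leNgt => /negP; apply.
by have := ltr_leD q1 (hs _ hgt0 hh0); rewrite subrK.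
Unshelve. all: by end_near. Qed.

Lemma derivative_approx (S : seq 'rV[R]_n) (M eps : R) : 0 < eps ->
  (forall x, x \in S -> box a b x) ->
  exists N p, [/\ (0 < N)%N, grid_partition a b N p,
    forall x, x \in S -> adapted N p x &
    exists G Z : set (lebesgue_rV R n), [/\ measurable G, measurable Z,
      (mu G <= eps%:E)%E, mu Z = 0%E &
      forall x, box a b x -> ~ Z x -> exists2 j : {ffun 'I_n -> 'I_N},
        open_cell p j x & good_cell f M p j -> ~ G x ->
          `|joint_derivative a b f x - slope p j| <= eps]].
Proof.
move=> eps0 Sab.
have [N [p [N0 gp pS [G [mG muG] GP]]]] := flat_derivative M eps0 Sab.
have [Z1 [mZ1 muZ1 ZP1]] := grid_faces N0 gp.
have [Z2 [mZ2 muZ2 ZP2]] := ae_joint_derivable.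
exists N, p; split => //; exists G, (Z1 `|` Z2); split => //.
- exact: measurableU.
- apply/eqP; rewrite eq_le measure_ge0 andbT.
  apply: le_trans (measureU2 _ _ _) _ => //.
  by rewrite [X in (X + _)%E]muZ1 [X in (_ + X)%E]muZ2 adde0.
- move=> x xab /not_orP[Z1x Z2x]; have [j jx] := ZP1 x xab Z1x.
  exists j => // good Gx; have [h0 h00 hP] := GP j x good jx Gx.
  exact: (joint_derivative_near (ZP2 x xab Z2x) h00 hP).
Qed.

End derivative.
(** * Comparison of the integral with the variation *)

Section inequalities.
Context {R : realType} {n : nat}.
Implicit Types (N : nat) (p : 'I_n -> nat -> R).
Variables (a b : 'rV[R]_n) (f : 'rV[R]_n -> R) (V : R).
Hypothesis ab : forall i, a 0 i < b 0 i.
Hypothesis fV : forall N p, (0 < N)%N -> grid_partition a b N p ->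
  grid_variation f N p <= V.

Local Notation mu := (lebesgue_measure_rV n).
Local Notation slope p j := (mean_slope f (cell_lo p j) (cell_hi p j)).
Local Notation incr p j := (joint_increment f (cell_lo p j) (cell_hi p j)).

Definition lebesgue_cell p N (j : {ffun 'I_n -> 'I_N}) : set (lebesgue_rV R n) :=
  box (cell_lo p j) (cell_hi p j).

Lemma measurable_cell p N (j : {ffun 'I_n -> 'I_N}) :
  measurable (lebesgue_cell p j).
Proof. exact: measurable_lebesgue_box. Qed.

Lemma lebesgue_measure_cell p N (j : {ffun 'I_n -> 'I_N}) :
  grid_partition a b N p ->
  mu (lebesgue_cell p j) = (volume (cell_lo p j) (cell_hi p j))%:E.
Proof. by move=> gp; apply: lebesgue_box => i; exact/ltW/(cell_lt gp). Qed.

Lemma open_cell_sub p N (j : {ffun 'I_n -> 'I_N}) :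
  open_cell p j `<=` lebesgue_cell p j.
Proof.
by move=> x jx i; rewrite cell_loE cell_hiE; have /andP[/ltW -> /ltW ->] := jx i.
Qed.

Lemma norm_slope_volume p N (j : {ffun 'I_n -> 'I_N}) : grid_partition a b N p ->
  `|slope p j| * volume (cell_lo p j) (cell_hi p j) = `|incr p j|.
Proof.
move=> gp; have v0 := volume_gt0 (cell_lt gp j).
by rewrite normf_div (gtr0_norm v0) divfK// gt_eqF.
Qed.

(** What the boxes use of the variation is lost for the cells outside of them. *)
Lemma increments_le_variation N p (K : finType) (c d : K -> 'rV[R]_n) :
  (0 < N)%N -> grid_partition a b N p ->
  (forall k i, c k 0 i <= d k 0 i) ->
  (forall k, adapted N p (c k)) -> (forall k, adapted N p (d k)) ->
  (forall k l, k != l -> nonoverlapping (c k) (d k) (c l) (d l)) ->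
  \sum_(j : {ffun 'I_n -> 'I_N} |
      ~~ [exists k, subbox (cell_lo p j) (cell_hi p j) (c k) (d k)]) `|incr p j| <=
  V - \sum_k `|joint_increment f (c k) (d k)|.
Proof.
move=> N0 gp cd pc pd cdN; rewrite lerBrDr; apply: le_trans (fV N0 gp).
rewrite /grid_variation [leRHS](bigID (fun j => [exists k,
  subbox (cell_lo p j) (cell_hi p j) (c k) (d k)]))/= [leRHS]addrC lerD2l.
apply: le_trans (sum_nonoverlapping gp cdN (fun j => normr_ge0 (incr p j))).
by apply: ler_sum => k _; exact: norm_increment_cells.
Qed.

(** A bounded function [g] below the derivative is, up to [eps] and outside of a
    small set, at most the modulus of the mean slope on the good cells, which
    integrates to the variation of [f] over these cells.  On the boxes
    [box (c k) (d k)] the bound [C] is used instead, so that the variation over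
    them can be subtracted.  Without boxes this bounds the integral of the
    derivative by the variation; with boxes it gives the absolute continuity
    when the two are equal. *)
Lemma integral_simple_le (g : lebesgue_rV R n -> R) (C tau : R) (K : finType)
    (c d : K -> 'rV[R]_n) : 0 <= C -> 0 < tau ->
  (forall x, 0 <= g x <= C) ->
  (forall x, box a b x -> g x <= `|joint_derivative a b f x|) ->
  (forall x, ~ box a b x -> g x = 0) ->
  (forall k i, c k 0 i <= d k 0 i) -> (forall k, subbox (c k) (d k) a b) ->
  (forall k l, k != l -> nonoverlapping (c k) (d k) (c l) (d l)) ->
  (\int[mu]_x (g x)%:E <= (V - \sum_k `|joint_increment f (c k) (d k)| +
    C * \sum_k volume (c k) (d k) + tau)%:E)%E.
Proof.
move=> C0 tau0 gC gD g0 cd cdab cdN.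
have V0 := variation_bound_ge0 ab fV.
have vol0 := volume_gt0 ab.
pose M := 2 * (C * V + 1) / tau.
have CV0 : 0 <= C * V by rewrite mulr_ge0.
have M0 : 0 < M by rewrite divr_gt0// mulr_gt0// ltr_wpDl.
pose eps := tau / (2 * (volume a b + C)).
have eps0 : 0 < eps by rewrite divr_gt0// mulr_gt0// ltr_pwDl.
pose S := [seq c k | k <- enum K] ++ [seq d k | k <- enum K].
have Sab x : x \in S -> box a b x.
  rewrite mem_cat => /orP[|] /mapP[k _ ->]; apply: (box_subbox (cdab k)) => i.
    by rewrite lexx cd.
  by rewrite lexx cd.
have [N [p [N0 gp pS [G [Z [mG mZ muG muZ approx]]]]]] :=
  derivative_approx ab fV M eps0 Sab.
have pc k : adapted N p (c k).
  by apply: pS; rewrite mem_cat map_f// mem_enum.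
have pd k : adapted N p (d k).
  by apply: pS; rewrite mem_cat orbC map_f// mem_enum.
pose inK (j : {ffun 'I_n -> 'I_N}) :=
  [exists k, subbox (cell_lo p j) (cell_hi p j) (c k) (d k)].
pose W (j : {ffun 'I_n -> 'I_N}) : R :=
  if good_cell f M p j then (if inK j then 0 else `|slope p j|) else C.
pose I k : set (lebesgue_rV R n) := box (c k) (d k).
pose B : set (lebesgue_rV R n) := box a b.
pose s : seq (R * set (lebesgue_rV R n)) :=
  [seq (W j, lebesgue_cell p j) | j <- index_enum {ffun 'I_n -> 'I_N}] ++
  [seq (C, I k) | k <- index_enum K] ++ [:: (eps, B); (C, G); (C, Z)].
have W0 j : 0 <= W j by rewrite /W; case: ifP => // _; case: ifP.
have mB : measurable B by exact: measurable_lebesgue_box.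
have mI k : measurable (I k) by exact: measurable_lebesgue_box.
have ss : nonneg_steps s.
  apply: nonneg_steps_cat.
    by apply: nonneg_steps_map => // j; exact: measurable_cell.
  apply: nonneg_steps_cat; first exact: (@nonneg_steps_map _ _ _ _ _ (fun=> C)).
  apply: nonneg_steps_cons => //=; first exact: ltW.
  apply: nonneg_steps_cons => //=; apply: nonneg_steps_cons => //=.
have stepsE x : steps s x = \sum_j W j * \1_(lebesgue_cell p j) x +
    (\sum_k C * \1_(I k) x + (eps * \1_B x + (C * \1_G x + C * \1_Z x))).
  rewrite !steps_cat (steps_map _ W) (steps_map _ (fun=> C)) !steps_cons.
  by rewrite /steps big_nil addr0.
have gs x : g x <= steps s x.
  have := steps_ge0 x ss; rewrite stepsE.
  set w1 := \sum_j _; set w2 := \sum_k _; set w3 := eps * _.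
  set w4 := C * \1_G x; set w5 := C * \1_Z x => sum0.
  have w10 : 0 <= w1 by apply: sumr_ge0 => j _; rewrite mulr_ge0.
  have w20 : 0 <= w2 by apply: sumr_ge0 => k _; rewrite mulr_ge0.
  have w30 : 0 <= w3 by rewrite mulr_ge0// ltW.
  have w40 : 0 <= w4 by rewrite mulr_ge0.
  have w50 : 0 <= w5 by rewrite mulr_ge0.
  have /andP[_ gCx] := gC x.
  have [xB|xB] := pselect (B x); last by rewrite g0.
  have [xZ|xZ] := pselect (Z x).
    have : w5 = C by rewrite /w5 indicE mem_set// mulr1.
    lra.
  have [xG|xG] := pselect (G x).
    have : w4 = C by rewrite /w4 indicE mem_set// mulr1.
    lra.
  have w3E : w3 = eps by rewrite /w3 indicE mem_set// mulr1.
  have [j jx near] := approx x xB xZ.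
  have w1W : W j <= w1.
    rewrite /w1 (bigD1 j)//= indicE mem_set ?mulr1; last exact: open_cell_sub.
    by rewrite lerDl sumr_ge0// => k _; rewrite mulr_ge0.
  move: w1W; rewrite /W; case: ifP => good; last by lra.
  case: ifPn => [/existsP[k jk] _|_ w1W].
    have : C <= w2.
      rewrite /w2 (bigD1 k)//= indicE mem_set ?mulr1.
        by rewrite lerDl sumr_ge0// => l _; rewrite mulr_ge0.
      by apply: (box_subbox jk); exact: (open_cell_sub jx).
    lra.
  have := near good xG; have := gD x xB.
  have := ler_distD (slope p j) (joint_derivative a b f x) 0; rewrite !subr0.
  lra.
apply: (@le_trans _ _ (\int[mu]_x (steps s x)%:E)%E).
  apply: integral_mono => x; rewrite lee_fin//.
  by have /andP[] := gC x.
rewrite integral_steps// /s !big_cat !big_map/= !big_cons big_nil/= muZ mule0 !adde0.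
rewrite (eq_bigr (fun j => (W j * volume (cell_lo p j) (cell_hi p j))%:E)); last first.
  by move=> j _; rewrite lebesgue_measure_cell.
rewrite sumEFin (eq_bigr (fun k => (C * volume (c k) (d k))%:E)); last first.
  by move=> k _; rewrite /I lebesgue_box// EFinM.
rewrite sumEFin -mulr_sumr lebesgue_box; last by move=> i; exact: ltW.
have CG : (C%:E * mu G <= (C * eps)%:E)%E.
  by rewrite EFinM lee_wpmul2l// lee_fin.
apply: le_trans (leeD (lexx _) (leeD (lexx _) (leeD (lexx _) CG))) _.
rewrite -EFinM -!EFinD lee_fin.
have epsE : eps * volume a b + C * eps = tau / 2.
  by rewrite /eps; field; rewrite gt_eqF// ltr_pwDl.
have CVM : C / M * V <= tau / 2.
  rewrite /M invf_div mulrA mulrAC ler_pdivrMr ?mulr_gt0 ?ltr_wpDl//.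
  by have := tau0; nra.
have CM0 : 0 <= C / M by rewrite divr_ge0// ltW.
have Wle : \sum_j W j * volume (cell_lo p j) (cell_hi p j) <=
    C / M * V + (V - \sum_k `|joint_increment f (c k) (d k)|).
  apply: (@le_trans _ _ (\sum_j (C / M * `|incr p j| +
      (if ~~ inK j then `|incr p j| else 0)))).
    apply: ler_sum => j _; rewrite -(norm_slope_volume j gp).
    have v0 := volume_gt0 (cell_lt gp j).
    rewrite /W /good_cell; case: (leP `|slope p j| M) => bad.
      case: ifP => _ /=; first by rewrite mul0r addr0 mulr_ge0// mulr_ge0// ltW.
      by rewrite lerDr mulr_ge0// mulr_ge0// ltW.
    have h : C <= C / M * `|slope p j|.
      by rewrite -mulrA ler_peMr// mulrC ler_pdivlMr// mul1r ltW.
    rewrite -[leLHS]addr0 lerD//; first by rewrite mulrA ler_pM2r.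
    by case: ifP => // _; rewrite mulr_ge0// ltW.
  rewrite big_split/= -mulr_sumr lerD//.
    by rewrite ler_wpM2l//; exact: (fV N0 gp).
  rewrite -big_mkcond.
  exact: increments_le_variation.
lra.
Qed.

End inequalities.
Section equality.
Context {R : realType} {n : nat}.
Implicit Types (N : nat) (p : 'I_n -> nat -> R).
Variables (a b : 'rV[R]_n) (f : 'rV[R]_n -> R) (V : R).
Hypothesis ab : forall i, a 0 i < b 0 i.
Hypothesis fV : forall N p, (0 < N)%N -> grid_partition a b N p ->
  grid_variation f N p <= V.

Local Notation mu := (lebesgue_measure_rV n).
Local Notation slope p j := (mean_slope f (cell_lo p j) (cell_hi p j)).
Local Notation incr p j := (joint_increment f (cell_lo p j) (cell_hi p j)).

Lemma open_cell_unique N p (j k : {ffun 'I_n -> 'I_N}) x :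
  grid_partition a b N p -> open_cell p j x -> lebesgue_cell p k x -> k = j.
Proof.
move=> gp jx kx; apply/ffunP => i; apply/val_inj => /=.
have /andP[j1 j2] := jx i; have := kx i; rewrite cell_loE cell_hiE => /andP[k1 k2].
have := le_lt_trans k1 j2; have := lt_le_trans j1 k2.
rewrite !ltNge !(grid_leE gp)//; try exact: ltnW.
by rewrite -!ltnNge !ltnS => h1 h2; apply/eqP; rewrite eqn_leq h1 h2.
Qed.

(** The only use of absolute continuity: the bad cells, of small volume, carry
    little variation. *)
Lemma bad_cells_increments N p (M e delta : R) : 0 < M -> V / M < delta ->
  (0 < N)%N -> grid_partition a b N p ->
  (forall (N : nat) (c d : 'I_N -> 'rV[R]_n),
      (forall k i, c k 0 i <= d k 0 i) ->
      (forall k, box (c k) (d k) `<=` box a b) ->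
      (forall k l, k != l ->
        (box (c k) (d k))° `&` (box (c l) (d l))° = set0) ->
      (\sum_(k < N) mu (box (c k) (d k)) < delta%:E)%E ->
      \sum_(k < N) `|joint_increment f (c k) (d k)| < e) ->
  \sum_(j : {ffun 'I_n -> 'I_N} | ~~ good_cell f M p j) `|incr p j| < e.
Proof.
move=> M0 VM N0 gp ac.
pose A : {pred {ffun 'I_n -> 'I_N}} := fun j => ~~ good_cell f M p j.
rewrite (big_enum_val (A := A)); apply: ac.
- by move=> k i; exact/ltW/(cell_lt gp).
- by move=> k; apply: box_subbox; exact: (cell_subbox gp).
- move=> k l kl; apply: interior_nonoverlapping; apply: (cells_nonoverlapping gp).
  by apply: contra kl => /eqP/enum_val_inj ->.
- under eq_bigr => k _ do rewrite (lebesgue_measure_cell (enum_val k) gp).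
  rewrite sumEFin lte_fin; apply: le_lt_trans VM.
  rewrite -(big_enum_val (A := A)
    (fun j => volume (cell_lo p j) (cell_hi p j))).
  exact: (bad_cells_volume fV).
Qed.

(** The modulus of the mean slope on the good cells is at most the derivative, up
    to [eps] and outside of a small set; its integral is the variation over the
    good cells, which is almost all the variation by [bad_cells_increments]. *)
Lemma integral_derivative_ge N1 p1 (e : R) : 0 < e ->
  joint_absolutely_continuous a b f ->
  (0 < N1)%N -> grid_partition a b N1 p1 ->
  ((grid_variation f N1 p1)%:E <=
    \int[mu]_(x in box a b) `|joint_derivative a b f x|%:E + (3 * e)%:E)%E.
Proof.
move=> e0 ac N10 gp1; have [delta delta0 acd] := ac e e0.
have V0 := variation_bound_ge0 ab fV.
have vol0 := volume_gt0 ab.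
pose M := V / delta + 1.
have M0 : 0 < M by rewrite ltr_wpDl// divr_ge0// ltW.
have VM : V / M < delta.
  by rewrite ltr_pdivrMr// /M mulrDr mulr1 mulrC divfK ?ltrDl// gt_eqF.
pose eps := e / (volume a b + M).
have eps0 : 0 < eps by rewrite divr_gt0// addr_gt0.
have [N [p [N0 gp pS [G [Z [mG mZ muG muZ approx]]]]]] :=
  derivative_approx ab fV M eps0 (fun x => @grid_points_box _ _ _ _ _ _ x gp1).
have pp1 := grid_points_refines pS.
pose W (j : {ffun 'I_n -> 'I_N}) : R :=
  if good_cell f M p j then `|slope p j| else 0.
have W0 j : 0 <= W j by rewrite /W; case: ifP.
(* Several closed cells overlap on the faces: [K] is a bound there. *)
pose K := \sum_j W j.
pose B : set (lebesgue_rV R n) := box a b.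
have mB : measurable B by exact: measurable_lebesgue_box.
pose s : seq (R * set (lebesgue_rV R n)) :=
  [seq (W j, lebesgue_cell p j) | j <- index_enum {ffun 'I_n -> 'I_N}].
pose t : seq (R * set (lebesgue_rV R n)) := [:: (eps, B); (M, G); (K, Z)].
have K0 : 0 <= K by exact: sumr_ge0.
have ss : nonneg_steps s by apply: nonneg_steps_map => // j; exact: measurable_cell.
have tt : nonneg_steps t.
  apply: nonneg_steps_cons => //=; first exact: ltW.
  by do 2?[apply: nonneg_steps_cons => //=; rewrite ?(ltW M0)//].
pose h : lebesgue_rV R n -> \bar R :=
  (fun x => `|joint_derivative a b f x|%:E) \_ B.
have h0 x : (0 <= h x)%E by rewrite /h /patch; case: ifP => // _; rewrite lee_fin.
have sE x : steps s x = \sum_j W j * \1_(lebesgue_cell p j) x.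
  by rewrite (steps_map _ W).
have tE x : steps t x = eps * \1_B x + (M * \1_G x + K * \1_Z x).
  by rewrite !steps_cons /steps big_nil addr0.
have le x : ((steps s x)%:E <= h x + (steps t x)%:E)%E.
  have t0 := steps_ge0 x tt.
  have [xB|xB] := pselect (B x); last first.
    rewrite sE big1 ?adde_ge0// => j _; rewrite indicE memNset ?mulr0// => xj.
    by apply: xB; exact: (box_subbox (cell_subbox gp j)).
  rewrite /h patchE mem_set// -EFinD lee_fin.
  have D0 := normr_ge0 (joint_derivative a b f x).
  have [xZ|xZ] := pselect (Z x).
    have sK : steps s x <= K.
      rewrite sE; apply: ler_sum => j _; rewrite indicE.
      by case: (_ \in _); rewrite ?mulr1 ?mulr0.
    have Z1 : \1_Z x = 1 :> R by rewrite indicE mem_set.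
    have h1 : 0 <= eps * \1_B x by rewrite mulr_ge0// ltW.
    have h2 : 0 <= M * \1_G x by rewrite mulr_ge0// ltW.
    by rewrite tE Z1 mulr1; lra.
  have [j jx near] := approx x xB xZ.
  have -> : steps s x = W j.
    rewrite sE (bigD1 j)//= indicE mem_set ?mulr1; last exact: open_cell_sub.
    rewrite big1 ?addr0// => k kj; rewrite indicE memNset ?mulr0// => kx.
    by move: kj; rewrite (open_cell_unique gp jx kx) eqxx.
  rewrite /W; case: ifP => good; last by rewrite addr_ge0.
  have B1 : \1_B x = 1 :> R by rewrite indicE mem_set.
  have hZ : 0 <= K * \1_Z x by rewrite mulr_ge0.
  rewrite tE B1 mulr1; have [xG|xG] := pselect (G x).
    have G1 : \1_G x = 1 :> R by rewrite indicE mem_set.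
    by rewrite G1 mulr1; move: good; rewrite /good_cell; lra.
  have hG : 0 <= M * \1_G x by rewrite mulr_ge0// ltW.
  have := near good xG.
  have := ler_distD (joint_derivative a b f x) (slope p j) 0; rewrite !subr0.
  by rewrite distrC; lra.
have := integral_sub_le mu (measurable_steps ss) (measurable_steps tt)
  (fun x => steps_ge0 x ss) (fun x => steps_ge0 x tt) h0 le.
rewrite !integral_steps// -integral_mkcond !big_cons big_nil/= muZ mule0 !adde0.
rewrite big_map/= (eq_bigr (fun j => (W j * volume (cell_lo p j) (cell_hi p j))%:E)).
  2: by move=> j _; rewrite (lebesgue_measure_cell _ gp).
rewrite sumEFin lebesgue_box; last by move=> i; exact: ltW.
move=> main.
have {}main : ((\sum_j W j * volume (cell_lo p j) (cell_hi p j))%:E <=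
    \int[mu]_(x in box a b) `|joint_derivative a b f x|%:E + e%:E)%E.
  apply: (le_trans main); rewrite leeD2l//.
  have -> : e = eps * volume a b + M * eps.
    by rewrite /eps; field; rewrite gt_eqF// addr_gt0.
  rewrite [leRHS]EFinD EFinM leeD2l// EFinM lee_wpmul2l// lee_fin.
  exact: ltW.
have goodE : \sum_j W j * volume (cell_lo p j) (cell_hi p j) =
    \sum_(j : {ffun 'I_n -> 'I_N} | good_cell f M p j) `|incr p j|.
  rewrite [RHS]big_mkcond/=; apply: eq_bigr => j _; rewrite /W.
  by case: ifP => _; rewrite ?mul0r// (norm_slope_volume f j gp).
have bad := bad_cells_increments M0 VM N0 gp acd.
have ref := grid_variation_refines f gp gp1 pp1.
have le3 : grid_variation f N1 p1 <=
    \sum_j W j * volume (cell_lo p j) (cell_hi p j) + e.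
  apply: (le_trans ref); rewrite goodE /grid_variation.
  by rewrite (bigID (good_cell f M p))/= lerD2l ltW.
apply: (@le_trans _ _ (\sum_j W j * volume (cell_lo p j) (cell_hi p j) + e)%:E).
  by rewrite lee_fin.
rewrite EFinD (le_trans (leeD2r _ main))// -addeA leeD2l// -EFinD lee_fin.
by rewrite -[e in leLHS]mul1r -mulrDl ler_pM2r//; lra.
Qed.

Section simple_functions.
Import HBNNSimple.

Lemma simple_below_derivative (h : {nnsfun lebesgue_rV R n >-> R}) :
  (forall x, ((h x)%:E <=
    ((fun x => `|joint_derivative a b f x|%:E) \_ (box a b)) x)%E) ->
  exists2 C, 0 <= C & [/\ forall x, 0 <= h x <= C,
    forall x, box a b x -> h x <= `|joint_derivative a b f x| &
    forall x, ~ box a b x -> h x = 0].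
Proof.
move=> hD; have [M [Mr hM]] := simple_bounded h.
have h0 x : 0 <= h x by exact: fun_ge0.
exists (`|M| + 1); first by rewrite addr_ge0.
split=> x.
- rewrite h0/=; have := hM (`|M| + 1).
  rewrite (le_lt_trans (ler_norm _)) ?ltrDl// => /(_ isT x Logic.I).
  by rewrite /= ger0_norm.
- by move=> xB; have := hD x; rewrite patchE mem_set// lee_fin.
- move=> xB; have := hD x; rewrite patchE memNset// lee_fin => hx.
  by apply/eqP; rewrite eq_le hx h0.
Qed.

Lemma integral_derivative_le :
  (\int[mu]_(x in box a b) `|joint_derivative a b f x|%:E <= V%:E)%E.
Proof.
rewrite ge0_integralE => [|x _]; last by rewrite lee_fin.
apply: ge_ereal_sup => _ [h /= hD <-].
have [C C0 [hC hB h0]] := simple_below_derivative hD.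
apply/lee_addgt0Pr => tau tau0; rewrite -integralT_nnsfun.
have := @integral_simple_le _ _ a b f V ab fV h C tau 'I_0
  (fun _ => a) (fun _ => b) C0 tau0 hC hB h0.
by rewrite !big_ord0 subr0 mulr0 addr0 EFinD; apply; case.
Qed.

(** If the integral is the whole variation, a simple function [h] below the
    derivative already carries the variation up to [e / 3].  Boxes of small volume
    carry little of the integral of [h], and [integral_simple_le] turns this
    into a bound of their increments. *)
Lemma absolutely_continuous_integral :
  (\int[mu]_(x in box a b) `|joint_derivative a b f x|%:E)%E = V%:E ->
  joint_absolutely_continuous a b f.
Proof.
move=> DV e e0; have e30 : 0 < e / 3 by rewrite divr_gt0.
have : ((V - e / 3)%:E <
    \int[mu]_(x in box a b) `|joint_derivative a b f x|%:E)%E.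
  by rewrite DV lte_fin ltrBlDr ltrDl.
rewrite ge0_integralE => [|x _]; last by rewrite lee_fin.
move=> /ereal_sup_gt[_ [h /= hD <-] Vh].
have [C C0 [hC hB h0]] := simple_below_derivative hD.
exists (e / 3 / (C + 1)); first by rewrite divr_gt0// ltr_wpDl.
move=> N c d cd cdab cdN small.
have sub k : subbox (c k) (d k) a b.
  have ck : box (c k) (d k) (c k) by move=> i; rewrite lexx cd.
  have dk : box (c k) (d k) (d k) by move=> i; rewrite lexx cd.
  apply/subboxP => i.
  by have /andP[-> _] := cdab k _ ck i; have /andP[_ ->] := cdab k _ dk i.
have le := @integral_simple_le _ _ a b f V ab fV h C (e / 3) 'I_N c d
  C0 e30 hC hB h0 cd sub (fun k l kl => nonoverlapping_interior (cdN k l kl)).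
move: small; under eq_bigr => k _ do rewrite lebesgue_box//.
rewrite sumEFin lte_fin => small.
rewrite -integralT_nnsfun in Vh; have := lt_le_trans Vh le; rewrite lte_fin.
have : C * \sum_(k < N) volume (c k) (d k) <= e / 3.
  have : 0 <= \sum_(k < N) volume (c k) (d k).
    by apply: sumr_ge0 => k _; exact: volume_ge0.
  by move: small; rewrite ltr_pdivlMr ?ltr_wpDl//; lra.
lra.
Qed.

End simple_functions.

End equality.

Theorem corollary1p6 (R : realType) (n : nat) (a b : 'rV[R]_n)
    (f : 'rV[R]_n -> R) :
  (1 <= n)%N ->
  (forall i, a 0 i < b 0 i) ->
  joint_bounded_variation a b f ->
  (joint_absolutely_continuous a b f <->
  (\int[lebesgue_measure_rV n]_(x in box a b)
     `|joint_derivative a b f x|%:E)%E = joint_variation a b f).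
Proof.
move=> _ ab bv.
have [V VE] : exists V : R, joint_variation a b f = V%:E.
  have [N [p [N0 gp]]] := exists_grid ab.
  exists (fine (joint_variation a b f)); rewrite fineK// ge0_fin_numE//.
  apply: ereal_sup_ge; exists (grid_variation f N p)%:E; first by exists N, p.
  by rewrite lee_fin; apply: sumr_ge0.
have fV N p : (0 < N)%N -> grid_partition a b N p -> grid_variation f N p <= V.
  by move=> N0 gp; rewrite -lee_fin -VE; apply: ereal_sup_ubound; exists N, p.
split=> [ac|]; last by rewrite VE; exact: absolutely_continuous_integral.
apply/eqP; rewrite eq_le VE (integral_derivative_le ab fV)/= -VE.
apply: ge_ereal_sup => _ [N [p [N0 gp ->]]]; apply/lee_addgt0Pr => e e0.
have e30 : 0 < e / 3 by rewrite divr_gt0.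
have := integral_derivative_ge ab fV e30 ac N0 gp.
by rewrite [3 * _]mulrC divfK.
Qed.
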